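(* There exists a polynomial-time algorithm that, given a 3-CNF-SAT formula $\Phi$ with $n$ variables and $m$ clauses, constructs an instance $(G,k)$ of Edge Clique Cover that is equivalent to $\Phi$ (i.e., $\Phi$ is satisfiable if and only if $(G,k)$ is a YES-instance), with $k = O(\log n)$ and $|V(G)| = O(n+m)$.
   Context: Edge Clique Cover: given an undirected graph $G$ and an integer $k$, decide whether there exist $k$ subgraphs of $G$, each of which is a complete graph (clique), such that every edge of $G$ is contained in at least one of these subgraphs. *)

(* Defs.v *)
From mathcomp Require Import all_boot.
Set Implicit Arguments.
Unset Strict Implicit.
Unset Printing Implicit Defensive.

(* A random access machine, programmed by structured commands over natural
   numbers.  A program uses finitely many unbounded arrays; a scalar variable is
   an array used at index 0 only.  The arithmetic is addition, truncated
   subtraction and halving, without multiplication, so that each step of a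
   given program lengthens the numbers in memory by O(1) bits and unit-cost time
   is polynomially related to Turing machine time. *)

Definition memory := nat -> nat -> nat.

Inductive expr : Type :=
| Const of nat
| Get of nat & expr
| Add of expr & expr
| Sub of expr & expr
| Half of expr.

Fixpoint eval (M : memory) (e : expr) : nat :=
  match e with
  | Const c => c
  | Get a e1 => M a (eval M e1)
  | Add e1 e2 => eval M e1 + eval M e2
  | Sub e1 e2 => eval M e1 - eval M e2
  | Half e1 => (eval M e1)./2
  end.

Fixpoint ecost (e : expr) : nat :=
  match e with
  | Const _ => 1
  | Get _ e1 | Half e1 => (ecost e1).+1
  | Add e1 e2 | Sub e1 e2 => (ecost e1 + ecost e2).+1
  end.

Definition update (M : memory) (a i v : nat) : memory :=
  fun b j => if (b == a) && (j == i) then v else M b j.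

Inductive cmd : Type :=
| Skip
| Store of nat & expr & expr (* Store a i e is a[i] := e *)
| Seq of cmd & cmd
| If of expr & cmd & cmd
| While of expr & cmd.

(* [run c M t M']: started in memory M, the command c halts in memory M' after
   exactly t steps.  Guards hold when they are nonzero. *)
Inductive run : cmd -> memory -> nat -> memory -> Prop :=
| RunSkip M : run Skip M 1 M
| RunStore a i e M :
    run (Store a i e) M (ecost i + ecost e).+1
        (update M a (eval M i) (eval M e))
| RunSeq c1 c2 M1 M2 M3 t1 t2 :
    run c1 M1 t1 M2 -> run c2 M2 t2 M3 -> run (Seq c1 c2) M1 (t1 + t2) M3
| RunIfTrue e c1 c2 M M' t :
    eval M e != 0 -> run c1 M t M' ->
    run (If e c1 c2) M (ecost e + t).+1 M'
| RunIfFalse e c1 c2 M M' t :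
    eval M e = 0 -> run c2 M t M' ->
    run (If e c1 c2) M (ecost e + t).+1 M'
| RunWhileTrue e c M1 M2 M3 t1 t2 :
    eval M1 e != 0 -> run c M1 t1 M2 -> run (While e c) M2 t2 M3 ->
    run (While e c) M1 (ecost e + t1 + t2).+1 M3
| RunWhileFalse e c M :
    eval M e = 0 -> run (While e c) M (ecost e).+1 M.

(* The input word is in array 0, and all other cells are 0. *)
Definition input_memory (w : seq nat) : memory :=
  fun a i => if a == 0 then nth 0 w i else 0.

(* The output word is read from array 1; the encodings used below are
   self-delimiting, so cells beyond its end are irrelevant. *)
Definition outputs (M : memory) (w : seq nat) : Prop :=
  forall i, i < size w -> M 1 i = nth 0 w i.

Definition polytime_computable (X Y : Type) (size_of : X -> nat)
    (encX : X -> seq nat) (encY : Y -> seq nat) (f : X -> Y) : Prop :=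
  exists (P : cmd) (c d : nat), forall x : X,
  exists (t : nat) (M : memory),
    [/\ run P (input_memory (encX x)) t M,
        t <= c * (size_of x).+1 ^ d
      & outputs M (encY (f x))].

(* The literal (x, b) is the variable x if b is true, and its negation
   otherwise. *)
Definition literal (n : nat) : Type := ('I_n * bool)%type.

(* The literals of a clause may coincide, which accounts for the clauses with
   one or two literals. *)
Record cnf3 : Type := Cnf3 {
  nvars : nat;
  clauses : seq (3.-tuple (literal nvars))
}.

Definition nclauses (Phi : cnf3) : nat := size (clauses Phi).

Definition satisfies (Phi : cnf3) (a : 'I_(nvars Phi) -> bool) : bool :=
  all (fun C : 3.-tuple (literal (nvars Phi)) =>
         has (fun l : literal (nvars Phi) => a l.1 == l.2) C)
      (clauses Phi).

Definition satisfiable (Phi : cnf3) : Prop :=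
  exists a : 'I_(nvars Phi) -> bool, satisfies a.

Definition encode_literal (n : nat) (l : literal n) : nat := l.1.*2 + l.2.

Definition encode_cnf3 (Phi : cnf3) : seq nat :=
  [:: nvars Phi, nclauses Phi
   & flatten [seq [seq encode_literal l | l <- tval C] | C <- clauses Phi]].

Definition cnf3_size (Phi : cnf3) : nat := nvars Phi + nclauses Phi.

Record sgraph : Type := SGraph {
  nverts : nat;
  adj : rel 'I_nverts;
  adj_sym : symmetric adj;
  adj_irr : irreflexive adj
}.

(* A complete subgraph of a simple graph is determined by its vertex set. *)
Definition clique (G : sgraph) (K : {set 'I_(nverts G)}) : Prop :=
  {in K &, forall u v, u != v -> adj u v}.

Definition ecc_instance : Type := (sgraph * nat)%type.

Definition edge_clique_cover (I : ecc_instance) : Prop :=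
  exists K : 'I_I.2 -> {set 'I_(nverts I.1)},
    (forall i, clique (K i)) /\
    (forall u v, adj u v -> exists i, (u \in K i) && (v \in K i)).

(* The number of vertices, the parameter, and the adjacency matrix by rows. *)
Definition encode_ecc (I : ecc_instance) : seq nat :=
  [:: nverts I.1, I.2
   & [seq nat_of_bool (@adj I.1 u v)
     | u <- enum 'I_(nverts I.1), v <- enum 'I_(nverts I.1)]].

(* Main.v *)
From HB Require Import structures.
From mathcomp Require Import all_boot zify.
Require Import Defs.
Set Implicit Arguments.
Unset Strict Implicit.
Unset Printing Implicit Defensive.

(* Satisfiability becomes 4-colourability of a graph on a vertex set W whose
   non-edges ("compatible" pairs) are covered by O(log n) independent sets.  W
   consists of the 2n literals, three vertices per clause and three palette
   vertices.  One colour class holds the true literals and one chosen position of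
   each clause; the palette keeps the false literals in a second class and the
   unchosen positions in the last two.
   Each vertex of W carries 19 optional codes of L = O(log n) bits, and two
   vertices are compatible iff at some coordinate both codes are present and not
   bitwise complementary.  This covers the compatible pairs by 19 * 2L sets, one
   for each coordinate, bit position and bit value.  Literal codes are chosen so
   that complementation is negation.  Clause vertices only see the literals of
   the clause, not its index, which is why k is O(log n) however large m is.
   In the edge clique cover instance, each of these sets is forced to be one of
   the cliques by a private vertex r_f; a vertex p adjacent to all of W and to
   nothing else forces the remaining 4 cliques to cover W. *)

(** * Forced cliques *)

(** A row lists, set by set, which sets contain a given vertex, so overlapping rows mean that some
    set contains both vertices. *)
Definition overlap (r1 r2 : seq bool) : bool :=
  has (fun b => b.1 && b.2) (zip r1 r2).

Lemma overlap_cat a b c d :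
  size a = size c -> overlap (a ++ b) (c ++ d) = overlap a c || overlap b d.
Proof. by move=> eq_ac; rewrite /overlap zip_cat // has_cat. Qed.

Lemma overlapC r1 r2 : overlap r1 r2 = overlap r2 r1.
Proof.
rewrite /overlap; elim: r1 r2 => [|a r1 IH] [|b r2] //=.
by rewrite andbC IH.
Qed.

Lemma overlap_nth N r1 r2 : size r1 = N -> size r2 = N ->
  overlap r1 r2 = has (fun f => nth false r1 f && nth false r2 f) (iota 0 N).
Proof.
elim: N r1 r2 => [|N IH] [|a r1] [|b r2] //= [s1] [s2].
by rewrite /overlap /= -/(overlap r1 r2) (IH r1 r2) // (iotaDl 1 0) has_map.
Qed.

Lemma overlapP N r1 r2 : size r1 = N -> size r2 = N ->
  reflect (exists f : 'I_N, nth false r1 f && nth false r2 f) (overlap r1 r2).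
Proof.
move=> s1 s2; rewrite (overlap_nth s1 s2); apply: (iffP hasP) => [[f]|[f ff]].
  by rewrite mem_iota => /andP[_ lt_f] ff; exists (Ordinal lt_f).
by exists (f : nat); rewrite // mem_iota /=.
Qed.

(* Rows of an incidence matrix: vertex rows ws, then p (in no set), z (in all of
   the N sets) and r_0, ..., r_(N-1) (r_g in the g-th set only).  The vertex z
   gives every r_g an edge even if the g-th set does not meet ws. *)
Definition all_rows (N : nat) (ws : seq (seq bool)) : seq (seq bool) :=
  ws ++ nseq N false :: nseq N true
     :: [seq [seq f == g | f <- iota 0 N] | g <- iota 0 N].

Definition row_adj (N : nat) (ws : seq (seq bool)) (u v : nat) : bool :=
  (u != v) &&
  [|| (u == size ws) && (v < size ws), (v == size ws) && (u < size ws)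
    | overlap (nth [::] (all_rows N ws) u) (nth [::] (all_rows N ws) v)].

Lemma row_adj_sym N ws u v : row_adj N ws u v = row_adj N ws v u.
Proof.
by rewrite /row_adj eq_sym overlapC; congr (_ && _); rewrite orbCA.
Qed.

Lemma row_adj_irr N ws u : row_adj N ws u u = false.
Proof. by rewrite /row_adj eqxx. Qed.

Definition row_graph (N : nat) (ws : seq (seq bool)) : sgraph :=
  @SGraph (size ws + N.+2) (fun u v => row_adj N ws u v)
    (fun u v => row_adj_sym N ws u v) (fun u => row_adj_irr N ws u).

Section Cover.

Variables (N q : nat) (ws : seq (seq bool)).
Hypothesis size_ws : forall r, r \in ws -> size r = N.

Let w := size ws.
Let rows := all_rows N ws.

Lemma nth_rows_w u : u < w -> nth [::] rows u = nth [::] ws u.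
Proof. by move=> lt_u; rewrite nth_cat lt_u. Qed.

Lemma nth_rows_p : nth [::] rows w = nseq N false.
Proof. by rewrite nth_cat ltnn subnn. Qed.

Lemma nth_rows_z : nth [::] rows w.+1 = nseq N true.
Proof. by rewrite nth_cat ltnNge leqnSn /= subSnn. Qed.

Lemma nth_rows_r g : g < N ->
  nth [::] rows (w + g.+2) = [seq f == g | f <- iota 0 N].
Proof.
move=> lt_g; rewrite nth_cat ltnNge leq_addr /= addKn /=.
by rewrite (nth_map 0) ?size_iota // nth_iota.
Qed.

Lemma all_rows_size : all (fun r => size r == N) rows.
Proof.
rewrite all_cat /= !size_nseq eqxx /=; apply/andP; split.
  by apply/allP => r /size_ws/eqP.
by apply/allP => r /mapP[g _ ->]; rewrite size_map size_iota.
Qed.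

Lemma size_all_rows : size rows = w + N.+2.
Proof. by rewrite size_cat /= size_map size_iota. Qed.

Lemma size_nth_rows u : u < w + N.+2 -> size (nth [::] rows u) = N.
Proof.
by move=> lt_u; have/(all_nthP [::]) H := all_rows_size; apply/eqP/H; rewrite size_all_rows.
Qed.

Lemma row_adj_p u : u < w -> row_adj N ws w u.
Proof. by move=> lt_u; rewrite /row_adj gtn_eqF // eqxx lt_u. Qed.

Lemma row_adj_pr g : g < N -> row_adj N ws w (w + g.+2) = false.
Proof.
move=> lt_g; rewrite /row_adj -/rows nth_rows_p nth_rows_r //.
rewrite (_ : (_ + g.+2 < _) = false) ?ltnn ?andbF; last by apply/negbTE; lia.
rewrite /= (overlap_nth (N := N)) ?size_nseq ?size_map ?size_iota //.
by rewrite (@eq_has _ _ pred0) ?has_pred0 ?andbF // => f; rewrite nth_nseq if_same.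
Qed.

Lemma row_adj_zr g : g < N -> row_adj N ws w.+1 (w + g.+2).
Proof.
move=> lt_g; rewrite /row_adj -/rows nth_rows_z nth_rows_r //.
apply/andP; split; first by lia.
apply/orP; right; apply/orP; right.
apply/(@overlapP N); rewrite ?size_nseq ?size_map ?size_iota //.
exists (Ordinal lt_g); rewrite nth_nseq lt_g (nth_map 0) ?size_iota //=.
by rewrite nth_iota.
Qed.

Lemma row_adj_rr g h : g < N -> h < N -> row_adj N ws (w + g.+2) (w + h.+2) = false.
Proof.
move=> lt_g lt_h; rewrite /row_adj -/rows !nth_rows_r //.
case: eqVneq => //= ne_gh; rewrite !ltnNge !leq_addr !andbF /=.
apply/negbTE/negP => /(@overlapP N)[||f]; rewrite ?size_map ?size_iota //.
rewrite !(nth_map 0) ?size_iota // !nth_iota // => /andP[/eqP fg /eqP fh].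
by case/eqP: ne_gh; rewrite -fg -fh.
Qed.

(* The edges z r_f force one clique inside the f-th set each; the star of p must
   then be covered by the remaining q cliques. *)
Lemma row_graph_cover :
  edge_clique_cover (row_graph N ws, N + q) <->
  exists col : 'I_(size ws) -> 'I_q, forall u v : 'I_(size ws), u != v ->
    col u = col v -> overlap (nth [::] ws u) (nth [::] ws v).
Proof.
split=> [[K [cliqueK coverK]]|[col col_ok]].
  have lt_w (u : 'I_w) : u < w + N.+2 by apply: ltn_addr.
  have lt_p : w < w + N.+2 by lia.
  have lt_z : w.+1 < w + N.+2 by lia.
  have lt_r (f : 'I_N) : w + f.+2 < w + N.+2 by rewrite ltn_add2l !ltnS.
  have adjK i u v (hu : u < w + N.+2) (hv : v < w + N.+2) :
      Ordinal hu \in K i -> Ordinal hv \in K i -> u != v -> row_adj N ws u v.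
    by move=> uK vK ne_uv; apply: (cliqueK i _ _ uK vK).
  have /fin_all_exists[io ioP] (f : 'I_N) : exists i,
      (Ordinal lt_z \in K i) && (Ordinal (lt_r f) \in K i).
    exact: (coverK (Ordinal lt_z) (Ordinal (lt_r f)) (row_adj_zr (ltn_ord f))).
  (* No clique contains both [r_f] and [r_g], as these are not adjacent; hence the [N] edges [z r_f]
     use up [N] different cliques. *)
  have io_inj : injective io.
    move=> f g eq_fg; apply/val_inj/eqP; apply: contraFT (row_adj_rr (ltn_ord f) (ltn_ord g)).
    move=> ne_fg; have /andP[_ fK] := ioP f; have /andP[_ gK] := ioP g.
    by apply: (adjK (io f) _ _ (lt_r f) (lt_r g)) => //; rewrite ?eq_fg // eqn_add2l !eqSS.
  pose S := ~: (io @: [set: 'I_N]).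
  have cardS : #|S| = q by rewrite cardsCs setCK card_imset // cardsT !card_ord addKn.
  have /fin_all_exists[sel selP] (u : 'I_w) : exists i,
      [&& i \in S, Ordinal lt_p \in K i & Ordinal (lt_w u) \in K i].
    have [i /andP[pK uK]] :=
      coverK (Ordinal lt_p) (Ordinal (lt_w u)) (row_adj_p (ltn_ord u)).
    (* The clique covering the edge from [p] to [u] is not a forced one: it would contain some
       [r_f], which is not adjacent to [p]. *)
    exists i; rewrite pK uK !andbT inE; apply/negP => /imsetP[f _ def_i].
    have /andP[_ fK] := ioP f; rewrite -def_i in fK.
    suff: row_adj N ws w (w + f.+2) by rewrite row_adj_pr.
    by apply: (adjK i) pK fK _; lia.
  (* The colour of [u] is the position of its clique among the [q] cliques that are not forced. *)
  have lt_q u : index (sel u) (enum S) < q.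
    by rewrite -[X in _ < X]cardS cardE index_mem mem_enum; case/and3P: (selP u).
  exists (fun u => Ordinal (lt_q u)) => u v ne_uv [eq_uv].
  have /and3P[Su pu uu] := selP u; have /and3P[Sv pv vv] := selP v.
  have eq_sel : sel u = sel v.
    by apply: (index_inj (sel u)) eq_uv; rewrite ?mem_enum.
  rewrite -eq_sel in vv.
  (* Neither vertex is [p], so of the three reasons for adjacency only the overlap of the rows
     remains. *)
  have := adjK _ _ _ _ _ uu vv ne_uv.
  by rewrite /row_adj -/rows !nth_rows_w // -/w !(ltn_eqF (ltn_ord _)) /= => /andP[].
(* Conversely, take the [N] sets themselves and the [q] colour classes, adding [p] to each class;
   [z] and the [r_g] lie in no class. *)
pose K (i : 'I_(N + q)) : {set 'I_(w + N.+2)} := match split i with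
  | inl f => [set u : 'I_(w + N.+2) | nth false (nth [::] rows u) f]
  | inr c => [set u : 'I_(w + N.+2) | if insub (u : nat) is Some u' then col u' == c
                                      else val u == w]
  end.
have pK c u : val u = w -> u \in K (rshift N c).
  by move=> eq_u; rewrite /K (unsplitK (inr _)) inE insubN /= eq_u ?ltnn.
have wK (u : 'I_(w + N.+2)) (lt_u : u < w) : u \in K (rshift N (col (Ordinal lt_u))).
  by rewrite /K (unsplitK (inr _)) inE insubT.
exists K; split=> [i u v|u v].
  rewrite /K /=; case: split => [f|c]; rewrite !inE => uK vK ne_uv; rewrite /row_adj ne_uv /=.
    apply/orP; right; apply/orP; right.
    by apply/(@overlapP N); rewrite ?size_nth_rows //; exists f; rewrite uK.
  move: uK vK; case: insubP => [u' lt_u eq_u|ge_u]; case: insubP => [v' lt_v eq_v|ge_v].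
  - move=> /eqP cu /eqP cv; apply/orP; right; apply/orP; right.
    rewrite -/rows !nth_rows_w // -eq_u -eq_v col_ok ?cu //.
    by rewrite -val_eqE /= eq_u eq_v.
  - by move=> _ ->; rewrite lt_u orbT.
  - by move=> ->; rewrite lt_v.
  - by move=> /eqP eu /eqP ev; rewrite -val_eqE /= eu ev eqxx in ne_uv.
rewrite /= => /andP[ne_uv /or3P[/andP[/eqP eu lt_v]|/andP[/eqP ev lt_u]|]].
- by exists (rshift N (col (Ordinal lt_v))); rewrite pK //= wK.
- by exists (rshift N (col (Ordinal lt_u))); rewrite [X in _ && X]pK // wK.
rewrite -/rows => /(@overlapP N)[||f /andP[uf vf]]; rewrite ?size_nth_rows //.
by exists (lshift q f); rewrite /K (unsplitK (inl _)) !inE uf vf.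
Qed.

End Cover.

(** * Vertex codes *)

(** Each bit, lowest first, is turned into two memberships, in the set for value 1 or in the set for
    value 0. Two present codes overlap exactly when they agree at some bit, and an absent code lies
    in no set. *)
Fixpoint codebits (L : nat) (c : option nat) : seq bool :=
  if L is L'.+1 then
    (if c is Some x then odd x else false)
    :: (if c is Some x then ~~ odd x else false)
    :: codebits L' (omap half c)
  else [::].

Lemma size_codebits L c : size (codebits L c) = L.*2.
Proof. by elim: L c => //= L IH c; rewrite IH. Qed.

Lemma overlap_codebits_None L c : overlap (codebits L None) (codebits L c) = false.
Proof. by rewrite /overlap; elim: L c => //= L IH c; rewrite IH. Qed.

(* Bitwise complementary codes are those with sum 2 ^ L - 1. *)
Lemma overlap_codebits L a b : a < 2 ^ L -> b < 2 ^ L ->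
  overlap (codebits L (Some a)) (codebits L (Some b)) = (a + b != (2 ^ L).-1).
Proof.
rewrite /overlap; elim: L a b => [|L IH] a b; first by case: a b => [|a] [|b].
rewrite expnS => lt_a lt_b /=.
rewrite IH; [|lia..].
have := expn_gt0 2 L; lia.
Qed.

Definition row (L : nat) (cs : seq (option nat)) : seq bool :=
  flatten [seq codebits L c | c <- cs].

Lemma size_row L cs : size (row L cs) = size cs * L.*2.
Proof. by elim: cs => //= c cs IH; rewrite size_cat IH size_codebits mulSn. Qed.

Lemma overlap_row L cs ds : overlap (row L cs) (row L ds) =
  has (fun cd => overlap (codebits L cd.1) (codebits L cd.2)) (zip cs ds).
Proof.
have overlap0 r : overlap [::] r = false by case: r.
elim: cs ds => [|c cs IH] [|d ds] //=; rewrite ?overlap0 //.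
  by rewrite overlapC overlap0.
by rewrite /row /= overlap_cat ?size_codebits // IH.
Qed.

(* Coordinates 0-2 relate position s of the clauses to the literals, and all the
   literals to one another; 3 relates the literals to palette vertex 0; 4-9 relate
   each clause position to palette vertices 1 and 2; 10-18 compare, for the
   position pairs (0,1), (1,2), (2,0), the three literals of two clauses. *)
Definition lit_codes (T : Type) (k : T) : seq (option T) :=
  nseq 4 (Some k) ++ nseq 15 None.

(** Polymorphic, so that one table serves for the numbers of the reduction and for the expressions
    of the program. When two positions are compared, one side carries the literal codes and the
    other their complements: a coordinate is then not complementary exactly when the two literals
    differ. A pair of [zero] codes is never complementary. *)
Definition cls_codes (T : Type) (zero : T) (k nk : nat -> T) (s : nat) :
    seq (option T) :=
  let ks := [:: Some (k 0); Some (k 1); Some (k 2)] in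
  let nks := [:: Some (nk 0); Some (nk 1); Some (nk 2)] in
  let off := nseq 3 None in
  let at_s r x := if s == r then Some x else None in
  [:: at_s 0 (k 0); at_s 1 (k 1); at_s 2 (k 2); None]
  ++ [:: at_s 0 zero; at_s 0 zero; at_s 1 zero; at_s 1 zero; at_s 2 zero; at_s 2 zero]
  ++ match s with
     | 0 => ks ++ off ++ nks
     | 1 => nks ++ ks ++ off
     | _ => off ++ nks ++ ks
     end.

(** Palette vertices 1 and 2 take alternate coordinates among 4-9, so both meet every clause vertex
    but not each other. *)
Definition pal_codes (T : Type) (zero k : T) (s : nat) : seq (option T) :=
  match s with
  | 0 => nseq 3 None ++ Some k :: nseq 15 None
  | 1 => nseq 4 None ++ flatten (nseq 3 [:: Some zero; None]) ++ nseq 9 None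
  | _ => nseq 4 None ++ flatten (nseq 3 [:: None; Some zero]) ++ nseq 9 None
  end.

(* Literals are numbered as by encode_literal; a clause vertex is given by the
   contents of its clause, so the vertices of equal clauses have equal codes. *)
Inductive vertex : Type :=
| Lit of nat
| Cls of seq nat & nat
| Pal of nat.

(** Odd numbers are the positive literals. The negative literal of variable [i] has code [i] and the
    positive one the bitwise complement [T - i]. *)
Definition lit_code (T e : nat) : nat := if odd e then T - e./2 else e./2.

Definition vertex_codes (n T : nat) (v : vertex) : seq (option nat) :=
  match v with
  | Lit e => lit_codes (lit_code T e)
  | Cls C s => cls_codes 0 (fun r => lit_code T (nth 0 C r))
                         (fun r => T - lit_code T (nth 0 C r)) s
  | Pal s => pal_codes 0 n s
  end.

Definition compatible (n L : nat) (v1 v2 : vertex) : bool :=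
  overlap (row L (vertex_codes n (2 ^ L).-1 v1)) (row L (vertex_codes n (2 ^ L).-1 v2)).

Definition neg_lit (e : nat) : nat := if odd e then e.-1 else e.+1.

Section Compatible.

Variables (n L : nat).
(** Room for [n] variables and a fresh one: the codes from 0 to [n] are disjoint from their
    complements, from [T - n] to [T]. *)
Hypothesis le_nL : n.*2.+2 <= 2 ^ L.

Let T := (2 ^ L).-1.

Lemma lit_code_le e : e < n.*2 -> lit_code T e <= T.
Proof. by rewrite /lit_code; case: ifP; lia. Qed.

Lemma lit_code_add e e' : e < n.*2 -> e' < n.*2 ->
  (lit_code T e + lit_code T e' == T) = (e' == neg_lit e).
Proof.
by rewrite /lit_code /neg_lit => lt_e lt_e'; do 2 case: ifP => ?; apply/idP/idP; lia.
Qed.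

Lemma lit_code_inj e e' : e < n.*2 -> e' < n.*2 ->
  (lit_code T e == lit_code T e') = (e == e').
Proof. by rewrite /lit_code => lt_e lt_e'; do 2 case: ifP => ?; apply/idP/idP; lia. Qed.

(* The code n of palette vertex 0 is that of a fresh negated variable. *)
Lemma lit_code_n e : e < n.*2 -> lit_code T e + n != T.
Proof. by rewrite /lit_code; case: ifP; lia. Qed.

Definition wf_vertex (v : vertex) : bool :=
  match v with
  | Lit e => e < n.*2
  | Cls C s => [&& size C == 3, all (ltn^~ n.*2) C & s < 3]
  | Pal s => s < 3
  end.

Let differ (c d : option nat) : bool :=
  if (c, d) is (Some a, Some b) then a + b != T else false.

Lemma vertex_codes_le v : wf_vertex v ->
  all (fun c => if c is Some a then a <= T else true) (vertex_codes n T v).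
Proof.
case: v => [e|C s|s] /=.
- by move=> /lit_code_le ->.
- case: C => [|a [|b [|c [|]]]] //= /andP[/and4P[la lb lc _] ls].
  by case: s ls => [|[|[|]]] //= _; rewrite !leq_subr !lit_code_le.
- by have le_n : n <= T; [lia | case: s => [|[|[|]]] //=; rewrite le_n].
Qed.

(** All codes fit into [L] bits, so each coordinate can be decided by the arithmetic test on the sum
    of its two codes. The tables below follow by inspecting the 19 coordinates. *)
Lemma compatibleE v1 v2 : wf_vertex v1 -> wf_vertex v2 ->
  compatible n L v1 v2 =
  has (fun cd => differ cd.1 cd.2) (zip (vertex_codes n T v1) (vertex_codes n T v2)).
Proof.
move=> /vertex_codes_le + /vertex_codes_le; rewrite /compatible overlap_row -/T.
elim: (vertex_codes n T v1) (vertex_codes n T v2) => [|c cs IH] [|d ds] //=.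
move=> /andP[le_c /IH{}IH] /andP[le_d /IH ->]; congr (_ || _).
case: c d le_c le_d => [a|] [b|] /= le_a le_b.
- by rewrite overlap_codebits //; lia.
- by rewrite overlapC overlap_codebits_None.
- exact: overlap_codebits_None.
- exact: overlap_codebits_None.
Qed.

Lemma compatible_Lit e e' : e < n.*2 -> e' < n.*2 ->
  compatible n L (Lit e) (Lit e') = (e' != neg_lit e).
Proof.
by move=> le le'; rewrite compatibleE // /differ /= lit_code_add //; case: eqP.
Qed.

(** Coordinate [s] is the only one present on both sides, and there the clause vertex carries the
    code of its own literal. *)
Lemma compatible_Lit_Cls e C s : wf_vertex (Lit e) -> wf_vertex (Cls C s) ->
  compatible n L (Lit e) (Cls C s) = (nth 0 C s != neg_lit e).
Proof.
move=> we wC; rewrite compatibleE // /differ /=; move: we wC => /= we.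
case: C => [|a [|b [|c [|]]]] //= /andP[/and4P[la lb lc _] ls].
by case: s ls => [|[|[|]]] //= _; rewrite lit_code_add ?orbF.
Qed.

Lemma compatible_Lit_Pal e s : wf_vertex (Lit e) -> wf_vertex (Pal s) ->
  compatible n L (Lit e) (Pal s) = (s == 0).
Proof.
move=> we ws; rewrite compatibleE // /differ /=; move: we ws => /= we.
by case: s => [|[|[|]]] //= _; rewrite lit_code_n.
Qed.

(** Both vertices have the code 0 at coordinate [4 + 2 * s], whatever their clauses are. *)
Lemma compatible_Cls_eq C C' s : wf_vertex (Cls C s) -> wf_vertex (Cls C' s) ->
  compatible n L (Cls C s) (Cls C' s).
Proof.
move=> wC wC'; rewrite compatibleE // /differ /=; have: 0 != T by lia.
by case/and3P: wC => _ _; case: s {wC'} => [|[|[|]]] //= _ ->; rewrite ?orbT.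
Qed.

(** Two positions share just the three coordinates of their position pair, which compare the clauses
    literal by literal. Hence the three vertices of a clause need distinct colours, while different
    clauses do not constrain each other here. *)
Lemma compatible_Cls_neq C C' s s' : wf_vertex (Cls C s) -> wf_vertex (Cls C' s') ->
  s != s' -> compatible n L (Cls C s) (Cls C' s') = (C != C').
Proof.
move=> wC wC' ne_s; rewrite compatibleE // /differ /=; move: wC wC' ne_s => /=.
case: C => [|a [|b [|c [|]]]] //= /andP[/and4P[la lb lc _] ls].
case: C' => [|a' [|b' [|c' [|]]]] //= /andP[/and4P[la' lb' lc' _] ls'].
have key x y : x < n.*2 -> y < n.*2 -> (lit_code T x + (T - lit_code T y) != T) = (x != y).
  by move=> lx ly; rewrite -(lit_code_inj lx ly); have := lit_code_le lx; have := lit_code_le ly; lia.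
have key' x y : x < n.*2 -> y < n.*2 -> (T - lit_code T x + lit_code T y != T) = (x != y).
  by move=> lx ly; rewrite addnC key // eq_sym.
by case: s ls => [|[|[|]]] // _; case: s' ls' => [|[|[|]]] //= _ _;
  rewrite ?key ?key' // !eqseq_cons !negb_and !orbF.
Qed.

Lemma compatible_Cls_Pal C s s' : wf_vertex (Cls C s) -> wf_vertex (Pal s') ->
  compatible n L (Cls C s) (Pal s') = (s' != 0).
Proof.
move=> wC ws; rewrite compatibleE // /differ /=; have: 0 != T by lia.
case/and3P: wC => _ _; case: s => [|[|[|]]] //= _;
  by case: s' ws => [|[|[|]]] //= _ ->; rewrite ?orbT.
Qed.

Lemma compatible_Pal s s' : wf_vertex (Pal s) -> wf_vertex (Pal s') ->
  compatible n L (Pal s) (Pal s') = (s == s').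
Proof.
move=> ws ws'; rewrite compatibleE // /differ /=.
have T_gt0 : 0 != T by lia.
have n_T : n + n != T by lia.
by case: s ws => [|[|[|]]] //= _; case: s' ws' => [|[|[|]]] //= _; rewrite ?n_T ?T_gt0.
Qed.

Lemma compatible_refl v : wf_vertex v -> compatible n L v v.
Proof.
case: v => [e|C s|s] wf; first rewrite compatible_Lit //.
- by rewrite /neg_lit; case: ifP; lia.
- exact: compatible_Cls_eq.
- by rewrite compatible_Pal.
Qed.

End Compatible.

(** * Colourings and assignments *)

Lemma compatibleC n L v1 v2 : compatible n L v1 v2 = compatible n L v2 v1.
Proof. exact: overlapC. Qed.

Definition vertex_code (v : vertex) : nat + seq nat * nat + nat :=
  match v with
  | Lit e => inl (inl e)
  | Cls C s => inl (inr (C, s))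
  | Pal s => inr s
  end.

Definition vertex_decode (x : nat + seq nat * nat + nat) : vertex :=
  match x with
  | inl (inl e) => Lit e
  | inl (inr (C, s)) => Cls C s
  | inr s => Pal s
  end.

Lemma vertex_codeK : cancel vertex_code vertex_decode.
Proof. by case. Qed.

HB.instance Definition _ := Equality.copy vertex (can_type vertex_codeK).

Lemma neg_litK : involutive neg_lit.
Proof. by move=> e; rewrite /neg_lit; case odd_e: (odd e); case: ifP; lia. Qed.

Lemma neg_lit_lt n e : e < n.*2 -> neg_lit e < n.*2.
Proof. by rewrite /neg_lit; case: ifP; lia. Qed.

Definition lit_true (val : nat -> bool) (e : nat) : bool := val e./2 == odd e.

Lemma lit_true_neg val e : lit_true val (neg_lit e) = ~~ lit_true val e.
Proof.
rewrite /lit_true /neg_lit; case: ifP => odd_e.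
  have ->: (e.-1)./2 = e./2 by lia.
  have ->: odd e.-1 = false by lia.
  by case: (val _).
have ->: e.+1./2 = e./2 by lia.
by rewrite /= odd_e; case: (val _).
Qed.

Definition vertex_list (n : nat) (Cs : seq (seq nat)) : seq vertex :=
  [seq Lit e | e <- iota 0 n.*2]
  ++ flatten [seq [seq Cls C s | s <- iota 0 3] | C <- Cs]
  ++ [seq Pal s | s <- iota 0 3].

Definition code_length (n : nat) : nat := (trunc_log 2 n).+2.

Lemma code_length_gt n : 0 < n -> n.*2.+2 <= 2 ^ code_length n.
Proof. by move=> n_gt0; have := trunc_log_ltn n (isT : 1 < 2); rewrite /code_length !expnS; lia. Qed.

Section Colouring.

Variables (n : nat) (Cs : seq (seq nat)).
Hypothesis n_gt0 : 0 < n.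
Hypothesis Cs_ok : forall C, C \in Cs -> (size C == 3) && all (ltn^~ n.*2) C.

Let L := code_length n.
Let le_nL : n.*2.+2 <= 2 ^ L := code_length_gt n_gt0.
Let vs := vertex_list n Cs.

Lemma mem_vs_Lit e : (Lit e \in vs) = (e < n.*2).
Proof.
rewrite !mem_cat; apply/idP/idP => [|lt_e]; last by rewrite map_f // mem_iota.
case/or3P => [/mapP[e']|/flatten_mapP[C _]|] /=.
- by rewrite mem_iota => /= lt_e [->].
- by rewrite !inE.
- by rewrite !inE.
Qed.

Lemma mem_vs_Cls C s : (Cls C s \in vs) = (C \in Cs) && (s < 3).
Proof.
rewrite !mem_cat; apply/idP/idP => [|/andP[CC lt_s]].
  case/or3P => [/mapP[e']|/flatten_mapP[C' CC']|] /=.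
  - by [].
  - by rewrite !inE => /or3P[] /eqP[-> ->]; rewrite CC'.
  - by rewrite !inE.
apply/orP; right; apply/orP; left; apply/flatten_mapP; exists C => //.
by rewrite map_f // mem_iota.
Qed.

Lemma mem_vs_Pal s : (Pal s \in vs) = (s < 3).
Proof.
rewrite !mem_cat; apply/idP/idP => [|lt_s]; last by rewrite (map_f Pal) ?orbT // mem_iota.
case/or3P => [/mapP[e']|/flatten_mapP[C _]|/mapP[s']] //=.
by rewrite !inE => /or3P[] /eqP-> [->].
Qed.

Lemma vs_wf v : v \in vs -> wf_vertex n v.
Proof.
case: v => [e|C s|s]; rewrite ?mem_vs_Lit ?mem_vs_Cls ?mem_vs_Pal //=.
by case/andP => /Cs_ok/andP[-> ->] ->.
Qed.

(** Depends on the cyclic offset of position [s] from the chosen position [h]; the added 3 keeps the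
    truncated subtraction exact. Colour 1 is skipped because palette vertex 0 has it. *)
Definition clause_colour (s h : nat) : nat := nth 0 [:: 0; 2; 3] ((s + 3 - h) %% 3).

(* Colour 0 collects the true literals and, in each clause, its first true
   position; colour 1 the false literals; the other two positions of each clause
   go to colours 2 and 3. *)
Definition colour (val : nat -> bool) (v : vertex) : nat :=
  match v with
  | Lit e => if lit_true val e then 0 else 1
  | Cls C s => clause_colour s (find (lit_true val) C)
  | Pal s => s.+1
  end.

Lemma colour_lt val v : v \in vs -> colour val v < 4.
Proof.
case: v => [e|C s|s] /=; first by case: ifP.
  rewrite /clause_colour; move: (ltn_pmod (s + 3 - find (lit_true val) C) (isT : 0 < 3)).
  by case: (_ %% 3) => [|[|[|]]].
by rewrite mem_vs_Pal.
Qed.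

Lemma colour_compatible val v1 v2 :
  (forall C, C \in Cs -> has (lit_true val) C) ->
  v1 \in vs -> v2 \in vs -> colour val v1 = colour val v2 -> compatible n L v1 v2.
Proof.
move=> sat; have find_lt C : C \in Cs -> find (lit_true val) C < 3.
  by move=> CC; have /andP[/eqP <- _] := Cs_ok CC; rewrite -has_find sat.
have LL e e' : Lit e \in vs -> Lit e' \in vs ->
    colour val (Lit e) = colour val (Lit e') -> compatible n L (Lit e) (Lit e').
  move=> /vs_wf we /vs_wf we'; rewrite compatible_Lit //= => eq_c.
  by apply/eqP => def_e'; move: eq_c; rewrite def_e' lit_true_neg; case: (lit_true _ _).
have LC e C s : Lit e \in vs -> Cls C s \in vs ->
    colour val (Lit e) = colour val (Cls C s) -> compatible n L (Lit e) (Cls C s).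
  move=> vL vC; have := vC; rewrite mem_vs_Cls => /andP[CC lt_s].
  rewrite (compatible_Lit_Cls le_nL (vs_wf vL) (vs_wf vC)) /= => eq_c.
  (* Colour 0 is the only one that literals and clause vertices have in common. *)
  have [lit_e eq_s] : lit_true val e /\ s = find (lit_true val) C.
    move: eq_c (find_lt _ CC) lt_s => /=; case: ifP => _;
    by case: s {vC} => [|[|[|]]] //; case: (find _ _) => [|[|[|]]].
  apply/eqP => def_s; have := nth_find 0 (sat _ CC).
  by rewrite -eq_s def_s lit_true_neg lit_e.
have CP C s s' : Cls C s \in vs -> Pal s' \in vs ->
    colour val (Cls C s) = colour val (Pal s') -> compatible n L (Cls C s) (Pal s').
  move=> vC vP; rewrite (compatible_Cls_Pal le_nL (vs_wf vC) (vs_wf vP)).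
  move: vC; rewrite mem_vs_Cls => /andP[/find_lt /=].
  by case: s' {vP} => //; case: (find _ _) s => [|[|[|]]] // [|[|[|]]].
have LP e s : Lit e \in vs -> Pal s \in vs ->
    colour val (Lit e) = colour val (Pal s) -> compatible n L (Lit e) (Pal s).
  move=> vL vP; rewrite (compatible_Lit_Pal le_nL (vs_wf vL) (vs_wf vP)) /=.
  by case: ifP => // _ [<-].
case: v1 v2 => [e|C s|s] [e'|C' s'|s'] vs1 vs2 eq_c.
- exact: LL.
- exact: LC.
- exact: LP.
- by rewrite compatibleC; apply: LC.
- have wf1 := vs_wf vs1; have wf2 := vs_wf vs2.
  have [eq_s|ne_s] := eqVneq s s'.
    by rewrite -eq_s in wf2 *; apply: (compatible_Cls_eq le_nL wf1 wf2).
  (* Equal clauses have the same chosen position, so different positions have different offsets and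
     thus different colours. *)
  rewrite (compatible_Cls_neq le_nL wf1 wf2 ne_s); apply/eqP => eq_C; move: eq_c ne_s => /=.
  move: vs1 vs2; rewrite !mem_vs_Cls -eq_C => /andP[/find_lt lt_h lt_s] /andP[_ lt_s'].
  move: lt_h lt_s lt_s'; case: (find _ _) => [|[|[|]]] //;
  by case: s {wf1 wf2} => [|[|[|]]] //; case: s' => [|[|[|]]].
- exact: CP.
- by rewrite compatibleC; apply: LP.
- by rewrite compatibleC; apply: CP.
- by rewrite (compatible_Pal le_nL (vs_wf vs1) (vs_wf vs2)); case: eq_c => ->.
Qed.

(* The colour other than those of the palette plays the role of "true". *)
Lemma colouring_sat (col : vertex -> nat) :
  (forall v, v \in vs -> col v < 4) ->
  (forall v1 v2, v1 \in vs -> v2 \in vs -> ~~ compatible n L v1 v2 -> col v1 != col v2) ->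
  let val i := col (Lit i.*2.+1) == 6 - (col (Pal 0) + col (Pal 1) + col (Pal 2)) in
  forall C, C \in Cs -> has (lit_true val) C.
Proof.
move=> col_lt col_ok val C CC.
have [vP0 vP1 vP2] : [/\ Pal 0 \in vs, Pal 1 \in vs & Pal 2 \in vs].
  by rewrite !mem_vs_Pal.
have PP s s' : Pal s \in vs -> Pal s' \in vs -> s != s' -> col (Pal s) != col (Pal s').
  move=> v1 v2 ne_s; apply: col_ok => //.
  by rewrite (compatible_Pal le_nL (vs_wf v1) (vs_wf v2)).
have P01 := PP 0 1 vP0 vP1 isT; have P02 := PP 0 2 vP0 vP2 isT; have P12 := PP 1 2 vP1 vP2 isT.
have lt0 := col_lt _ vP0; have lt1 := col_lt _ vP1; have lt2 := col_lt _ vP2.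
have litP e s : Lit e \in vs -> 0 < s < 3 -> col (Lit e) != col (Pal s).
  move=> vL /andP[s_gt0 s_lt]; have vP : Pal s \in vs by rewrite mem_vs_Pal.
  apply: col_ok => //; rewrite (compatible_Lit_Pal le_nL (vs_wf vL) (vs_wf vP)).
  by rewrite -lt0n.
have clsP s : s < 3 -> col (Cls C s) != col (Pal 0).
  move=> lt_s; have vC : Cls C s \in vs by rewrite mem_vs_Cls CC.
  by apply: col_ok => //; rewrite (compatible_Cls_Pal le_nL (vs_wf vC) (vs_wf vP0)).
have clsC s s' : s < 3 -> s' < 3 -> s != s' -> col (Cls C s) != col (Cls C s').
  move=> lt_s lt_s' ne_s.
  have vC : Cls C s \in vs by rewrite mem_vs_Cls CC.
  have vC' : Cls C s' \in vs by rewrite mem_vs_Cls CC.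
  apply: col_ok => //.
  by rewrite (compatible_Cls_neq le_nL (vs_wf vC) (vs_wf vC') ne_s) eqxx.
(* The colours 0, 1, 2, 3 add up to 6, so [A] is the one that the three palette vertices leave
   free. *)
pose A := 6 - (col (Pal 0) + col (Pal 1) + col (Pal 2)).
(* The three vertices of the clause have distinct colours, all different from that of palette vertex
   0; three colours are left, so each of them occurs, [A] included. *)
have [s lt_s colA] : exists2 s, s < 3 & col (Cls C s) = A.
  have c01 := clsC 0 1 isT isT isT; have c02 := clsC 0 2 isT isT isT.
  have c12 := clsC 1 2 isT isT isT.
  have p0 := clsP 0 isT; have p1 := clsP 1 isT; have p2 := clsP 2 isT.
  have l s : s < 3 -> col (Cls C s) < 4 by move=> lt_s; rewrite col_lt // mem_vs_Cls CC.
  have l0 := l 0 isT; have l1 := l 1 isT; have l2 := l 2 isT.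
  have: [|| col (Cls C 0) == A, col (Cls C 1) == A | col (Cls C 2) == A].
    rewrite /A; clear -P01 P02 P12 lt0 lt1 lt2 c01 c02 c12 p0 p1 p2 l0 l1 l2; lia.
  by case/or3P => /eqP ?; [exists 0 | exists 1 | exists 2].
have vC : Cls C s \in vs by rewrite mem_vs_Cls CC.
have /andP[/eqP sz_C /allP C_lt] := Cs_ok CC.
set e := nth 0 C s; have e_lt : e < n.*2 by apply/C_lt/mem_nth; rewrite sz_C.
have lit_two x : x < n.*2 -> [/\ col (Lit x) = A \/ col (Lit x) = col (Pal 0),
    col (Lit (neg_lit x)) = A \/ col (Lit (neg_lit x)) = col (Pal 0)
  & col (Lit x) != col (Lit (neg_lit x))].
  move=> lt_x; have lt_nx := neg_lit_lt lt_x.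
  have vx : Lit x \in vs by rewrite mem_vs_Lit.
  have vnx : Lit (neg_lit x) \in vs by rewrite mem_vs_Lit.
  have aux v : v \in vs -> col v != col (Pal 1) -> col v != col (Pal 2) ->
      col v = A \/ col v = col (Pal 0).
    by move=> /col_lt; rewrite /A; clear -P01 P02 P12 lt0 lt1 lt2; lia.
  split; try by apply: aux => //; apply: litP.
  by apply: col_ok => //; rewrite (compatible_Lit le_nL (vs_wf vx) (vs_wf vnx)) eqxx.
(* The clause vertex of colour [A] is incompatible with the negation of its literal. That negation
   therefore has the colour of palette vertex 0, which leaves [A] for the literal itself. *)
have ne_A : col (Lit (neg_lit e)) != A.
  have vN : Lit (neg_lit e) \in vs by rewrite mem_vs_Lit neg_lit_lt.
  rewrite -colA; apply: col_ok => //.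
  by rewrite (compatible_Lit_Cls le_nL (vs_wf vN) (vs_wf vC)) neg_litK eqxx.
have e_A : col (Lit e) = A.
  case: (lit_two e e_lt) => -[-> //|->] [nA|->]; last by rewrite eqxx.
  by rewrite nA eqxx in ne_A.
apply/hasP; exists e; first by apply: mem_nth; rewrite sz_C.
rewrite /lit_true /val -/A; case odd_e: (odd e).
  have ->: (e./2).*2.+1 = e by lia.
  by rewrite e_A eqxx.
have ->: (e./2).*2.+1 = neg_lit e by rewrite /neg_lit odd_e; lia.
by rewrite (negbTE ne_A).
Qed.

End Colouring.

(** * The reduction and its correctness *)

Definition num_forced (n : nat) : nat := 19 * (code_length n).*2.

Definition vertex_rows (n : nat) (Cs : seq (seq nat)) : seq (seq bool) :=
  [seq row (code_length n) (vertex_codes n (2 ^ code_length n).-1 v) | v <- vertex_list n Cs].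

Definition coded_clauses (Phi : cnf3) : seq (seq nat) :=
  [seq [seq encode_literal l | l <- tval C] | C <- clauses Phi].

Definition empty_graph : sgraph :=
  @SGraph 0 (fun _ _ => false) (fun _ _ => erefl) (fun _ => erefl).

(** A formula without variables has no clauses and is satisfiable. It goes to an empty YES-instance,
    since even the fixed palette and forcing vertices would exceed a bound linear in [n + m = 0]. *)
Definition reduction (Phi : cnf3) : ecc_instance :=
  if nvars Phi == 0 then (empty_graph, 0)
  else (row_graph (num_forced (nvars Phi))
          (vertex_rows (nvars Phi) (coded_clauses Phi)), num_forced (nvars Phi) + 4).

Lemma size_vertex_codes n T v : size (vertex_codes n T v) = 19.
Proof. by case: v => [e|C [|[|s]]|[|[|s]]]. Qed.

Lemma size_vertex_rows n Cs r : r \in vertex_rows n Cs -> size r = num_forced n.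
Proof. by case/mapP => v _ ->; rewrite size_row size_vertex_codes. Qed.

Lemma encode_literal_lt n (l : literal n) : encode_literal l < n.*2.
Proof. by case: l => [x b]; rewrite /encode_literal /=; have := ltn_ord x; case: b; lia. Qed.

Lemma coded_clauses_ok Phi C : C \in coded_clauses Phi ->
  (size C == 3) && all (ltn^~ (nvars Phi).*2) C.
Proof.
case/mapP => D _ ->; rewrite size_map size_tuple eqxx.
by apply/allP => _ /mapP[l _ ->]; apply: encode_literal_lt.
Qed.

Lemma satisfies_coded Phi (a : 'I_(nvars Phi) -> bool) (val : nat -> bool) :
  (forall i, val (nat_of_ord i) = a i) ->
  satisfies a = all (has (lit_true val)) (coded_clauses Phi).
Proof.
move=> def_a; rewrite all_map; apply: eq_all => C /=.
rewrite has_map; apply: eq_has => -[x b] /=.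
rewrite /lit_true /encode_literal /= -def_a oddD odd_double oddb.
by have ->: (x.*2 + b)./2 = x by case: b; lia.
Qed.

Lemma reduction_correct Phi : satisfiable Phi <-> edge_clique_cover (reduction Phi).
Proof.
rewrite /reduction; case: eqVneq => [n0|n_gt0].
  split=> _; first by exists (fun=> set0); split=> [[]|[]].
  have no_var (x : 'I_(nvars Phi)) : false by have := ltn_ord x; rewrite [X in _ < X]n0.
  exists (fun=> false); apply/allP => C _.
  by have := no_var (tnth C ord0).1.
rewrite -lt0n in n_gt0.
set n := nvars Phi in n_gt0 *; set Cs := coded_clauses Phi.
have Cs_ok := @coded_clauses_ok Phi; rewrite -/n -/Cs in Cs_ok.
rewrite row_graph_cover; last exact: size_vertex_rows.
have sz_rows : size (vertex_rows n Cs) = size (vertex_list n Cs) by rewrite size_map.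
have nth_rows u : u < size (vertex_list n Cs) -> nth [::] (vertex_rows n Cs) u =
    row (code_length n) (vertex_codes n (2 ^ code_length n).-1 (nth (Pal 0) (vertex_list n Cs) u)).
  by move=> lt_u; rewrite (nth_map (Pal 0)).
split=> [[a sat_a]|[col col_ok]].
  pose val i := if insub i is Some x then a x else false.
  have def_a (x : 'I_n) : val (nat_of_ord x) = a x by rewrite /val valK.
  rewrite (satisfies_coded def_a) in sat_a; have {}sat_a := allP sat_a.
  have lt_vs (u : 'I_(size (vertex_rows n Cs))) : u < size (vertex_list n Cs) by rewrite -sz_rows.
  have mem_vs (u : 'I_(size (vertex_rows n Cs))) :
    nth (Pal 0) (vertex_list n Cs) u \in vertex_list n Cs by apply: mem_nth.
  exists (fun u => Ordinal (colour_lt val (mem_vs u))) => u v _ [eq_c].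
  by rewrite !nth_rows //; apply: (colour_compatible n_gt0 Cs_ok sat_a) eq_c.
(* Repeated clauses make [vertex_list] repeat vertices; each vertex takes the colour of its first
   occurrence. The default 0 concerns only vertices outside the list. *)
pose c v := if insub (index v (vertex_list n Cs)) is Some u then nat_of_ord (col u) else 0.
have c_idx v : v \in vertex_list n Cs ->
    exists2 u : 'I_(size (vertex_rows n Cs)), nat_of_ord u = index v (vertex_list n Cs) & c v = col u.
  rewrite -index_mem -sz_rows => lt_v.
  by exists (Ordinal lt_v); rewrite // /c insubT.
pose val i := c (Lit i.*2.+1) == 6 - (c (Pal 0) + c (Pal 1) + c (Pal 2)).
exists (fun x : 'I_n => val x); rewrite (@satisfies_coded _ _ val) //.
apply/allP; apply: (colouring_sat n_gt0 Cs_ok) => [v /c_idx[u _ ->] //|v1 v2 vs1 vs2 incomp].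
have [u1 def1 ->] := c_idx _ vs1; have [u2 def2 ->] := c_idx _ vs2.
apply: contraNneq incomp => eq_c.
(* The colouring says nothing about a vertex and itself, so equal indices are settled by reflexivity
   of compatibility. *)
have [eq_u|ne_u] := eqVneq u1 u2.
  have eq_v : v1 = v2 by rewrite -(nth_index (Pal 0) vs1) -def1 eq_u def2 nth_index.
  by rewrite -eq_v (compatible_refl (code_length_gt n_gt0)) // (vs_wf Cs_ok).
have := col_ok _ _ ne_u (val_inj eq_c).
by rewrite !nth_rows ?def1 ?def2 ?index_mem // !nth_index.
Qed.

(** * Cost-bounded reasoning about programs *)

(** A total-correctness triple with a time budget. The budget is an upper bound, so that both
    branches of a conditional can share it. *)
Definition runs (c : cmd) (M : memory) (T : nat) (Q : memory -> Prop) : Prop :=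
  exists t M', [/\ run c M t M', t <= T & Q M'].

(** The frame condition: only arrays in [ms] may have changed. *)
Definition agree (ms : seq nat) (M M' : memory) : Prop :=
  forall a i, a \notin ms -> M' a i = M a i.

Lemma agree_refl ms M : agree ms M M.
Proof. by []. Qed.

Lemma agree_trans ms M1 M2 M3 : agree ms M1 M2 -> agree ms M2 M3 -> agree ms M1 M3.
Proof. by move=> a12 a23 a i a_ms; rewrite a23 // a12. Qed.

Lemma agree_sub ms ms' M M' : {subset ms <= ms'} -> agree ms M M' -> agree ms' M M'.
Proof. by move=> sub ag a i a_ms; apply: ag; apply: contra a_ms; apply: sub. Qed.

Lemma agree_update ms M M' a i v : a \in ms -> agree ms M M' -> agree ms M (update M' a i v).
Proof.
move=> a_ms ag b j b_ms; rewrite /update; case: eqVneq => [eq_b|_] /=; last exact: ag.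
by rewrite eq_b a_ms in b_ms.
Qed.

Lemma runs_weaken c M T T' (Q Q' : memory -> Prop) :
  runs c M T Q -> T <= T' -> (forall M', Q M' -> Q' M') -> runs c M T' Q'.
Proof.
move=> [t [M' [r le_t q]]] le_T QQ'; exists t, M'; split=> //; last exact: QQ'.
exact: leq_trans le_t le_T.
Qed.

Lemma runs_le c M T T' (Q : memory -> Prop) : T <= T' -> runs c M T Q -> runs c M T' Q.
Proof. by move=> le_T h; apply: runs_weaken h le_T _. Qed.

Lemma runs_skip M (Q : memory -> Prop) : Q M -> runs Skip M 1 Q.
Proof. by move=> q; exists 1, M; split=> //; apply: RunSkip. Qed.

Lemma runs_store a i e M (Q : memory -> Prop) :
  Q (update M a (eval M i) (eval M e)) -> runs (Store a i e) M (ecost i + ecost e).+1 Q.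
Proof. by move=> q; do 2 eexists; split; [apply: RunStore | | apply: q]. Qed.

Lemma runs_seq c1 c2 M T1 T2 (Q1 Q2 : memory -> Prop) :
  runs c1 M T1 Q1 -> (forall M', Q1 M' -> runs c2 M' T2 Q2) -> runs (Seq c1 c2) M (T1 + T2) Q2.
Proof.
move=> [t1 [M1 [r1 le1 /[swap]/[apply]]]] [t2 [M2 [r2 le2 q2]]].
by exists (t1 + t2), M2; split=> //; [apply: RunSeq r1 r2 | apply: leq_add].
Qed.

Lemma runs_if e c1 c2 M T (Q : memory -> Prop) :
  (eval M e != 0 -> runs c1 M T Q) -> (eval M e = 0 -> runs c2 M T Q) ->
  runs (If e c1 c2) M (ecost e + T).+1 Q.
Proof.
move=> h1 h2; case: (eqVneq (eval M e) 0) => [e0|e1].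
  have [t [M' [r le q]]] := h2 e0.
  by exists (ecost e + t).+1, M'; split=> //; [apply: RunIfFalse | rewrite ltnS leq_add2l].
have [t [M' [r le q]]] := h1 e1.
by exists (ecost e + t).+1, M'; split=> //; [apply: RunIfTrue | rewrite ltnS leq_add2l].
Qed.

Definition Reg (x : nat) : expr := Get x (Const 0).
Definition SetReg (x : nat) (e : expr) : cmd := Store x (Const 0) e.

Definition For (x : nat) (e : expr) (body : cmd) : cmd :=
  Seq (SetReg x (Const 0))
      (While (Sub e (Reg x)) (Seq body (SetReg x (Add (Reg x) (Const 1))))).

(** The initialisation and the last, failing test are charged as one more iteration; 12 covers the
    test and the increment of the counter. *)
Definition for_cost (e : expr) (b B : nat) : nat := b.+1 * (B + ecost e + 12).

Lemma runs_for x e body M b B (Inv : nat -> memory -> Prop) :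
  Inv 0 (update M x 0 0) ->
  (forall i M1, Inv i M1 -> M1 x 0 = i -> eval M1 e = b) ->
  (forall i M1, i < b -> Inv i M1 -> M1 x 0 = i ->
     runs body M1 B (fun M2 => M2 x 0 = i /\ Inv i.+1 (update M2 x 0 i.+1))) ->
  runs (For x e body) M (for_cost e b B) (Inv b).
Proof.
move=> inv0 bound step.
suff loop k : forall i M1, i + k = b -> Inv i M1 -> M1 x 0 = i ->
    runs (While (Sub e (Reg x)) (Seq body (SetReg x (Add (Reg x) (Const 1))))) M1
      (k * (B + ecost e + 12) + ecost e + 4) (Inv b).
  apply: (@runs_le _ _ (3 + (b * (B + ecost e + 12) + ecost e + 4))).
    by rewrite /for_cost mulSn; lia.
  apply: runs_seq (_ : runs _ _ _ (fun M' => M' = update M x 0 0)) _.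
    exact: runs_store.
  by move=> _ ->; apply: loop => //; rewrite /update !eqxx.
elim: k => [|k IH] i M1 def_b inv_i x_i.
  have e_b := bound _ _ inv_i x_i.
  exists (ecost (Sub e (Reg x))).+1, M1; split.
  - by apply: RunWhileFalse; rewrite /= x_i e_b; lia.
  - by rewrite /=; lia.
  - by rewrite -def_b addn0.
have e_b := bound _ _ inv_i x_i.
have [t [M2 [r le_t [x_M2 inv2]]]] := step i M1 ltac:(lia) inv_i x_i.
have [||t' [M3 [r' le_t' inv3]]] := IH i.+1 (update M2 x 0 i.+1) _ inv2.
- by rewrite -def_b addSnnS.
- by rewrite /update !eqxx.
exists (ecost (Sub e (Reg x)) + (t + 6) + t').+1, M3; split=> //; last first.
  by rewrite /= mulSn; lia.
apply: RunWhileTrue r'; first by rewrite /= x_i e_b; lia.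
apply: RunSeq r _.
have := @RunStore x (Const 0) (Add (Reg x) (Const 1)) M2.
by rewrite /= x_M2 (addn1 i).
Qed.

Fixpoint arrays (e : expr) : seq nat :=
  match e with
  | Const _ => [::]
  | Get a e1 => a :: arrays e1
  | Add e1 e2 | Sub e1 e2 => arrays e1 ++ arrays e2
  | Half e1 => arrays e1
  end.

Lemma eval_agree ms M M' e :
  all (fun a => a \notin ms) (arrays e) -> agree ms M M' -> eval M' e = eval M e.
Proof.
move=> + ag; elim: e => //= [a e IH|e1 IH1 e2 IH2|e1 IH1 e2 IH2|e IH].
- by move=> /andP[a_ms /IH ->]; apply: ag.
- by rewrite all_cat => /andP[/IH1 -> /IH2 ->].
- by rewrite all_cat => /andP[/IH1 -> /IH2 ->].
- by move=> /IH ->.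
Qed.

(* The array a is used as a stream, whose length is kept in the register p. *)
Definition stream (M : memory) (a p : nat) (s : seq nat) : Prop :=
  M p 0 = size s /\ forall i, M a i = nth 0 s i.

Lemma stream_agree ms M M' a p s :
  a \notin ms -> p \notin ms -> agree ms M M' -> stream M a p s -> stream M' a p s.
Proof. by move=> a_ms p_ms ag [sz st]; split=> [|i]; rewrite ag. Qed.

(** Quantifying over the earlier content [s0] lets the outputs of consecutive commands simply
    concatenate. *)
Definition emits (ms : seq nat) (a p : nat) (c : cmd) (T : nat) (s : seq nat)
    (M : memory) : Prop :=
  forall s0, stream M a p s0 ->
  runs c M T (fun M' => agree ms M M' /\ stream M' a p (s0 ++ s)).

Lemma emits_weaken ms ms' a p c T T' s M :
  emits ms a p c T s M -> {subset ms <= ms'} -> T <= T' -> emits ms' a p c T' s M.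
Proof.
move=> em sub le_T s0 /em h; apply: runs_weaken h le_T _ => M' [ag st].
by split=> //; apply: agree_sub ag.
Qed.

Lemma emits_skip ms a p M : emits ms a p Skip 1 [::] M.
Proof. by move=> s0 st; apply: runs_skip; rewrite cats0. Qed.

Lemma emits_seq ms a p c1 c2 T1 T2 s1 s2 M :
  emits ms a p c1 T1 s1 M -> (forall M', agree ms M M' -> emits ms a p c2 T2 s2 M') ->
  emits ms a p (Seq c1 c2) (T1 + T2) (s1 ++ s2) M.
Proof.
move=> em1 em2 s0 /em1 h1; apply: runs_seq h1 _ => M1 [ag1 st1].
apply: runs_weaken (em2 _ ag1 _ st1) (leqnn _) _ => M2 [ag2 st2].
by rewrite catA; split=> //; apply: agree_trans ag1 ag2.
Qed.

Definition Emit (a p : nat) (e : expr) : cmd :=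
  Seq (Store a (Reg p) e) (SetReg p (Add (Reg p) (Const 1))).

Lemma emits_emit ms a p e v M :
  a != p -> a \in ms -> p \in ms -> eval M e = v ->
  emits ms a p (Emit a p e) (ecost e + 9) [:: v] M.
Proof.
move=> ne_ap a_ms p_ms def_v s0 [sz st].
apply: (@runs_le _ _ ((ecost (Reg p) + ecost e).+1 + 6)); first by rewrite /=; lia.
apply: (runs_seq (Q1 := fun M' => M' = update M a (size s0) v)).
  by apply: runs_store; rewrite /= sz def_v.
move=> _ ->; apply: runs_store; split; first exact: (agree_update _ _ p_ms (agree_update _ _ a_ms (@agree_refl ms M))).
rewrite cats1; split=> [|i]; rewrite /update /= ?eqxx ?size_rcons.
  by rewrite eq_sym (negbTE ne_ap) /= sz addn1.
rewrite (negbTE ne_ap) /= nth_rcons st.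
by case: ltngtP => // lt_i; rewrite ?nth_default ?eqxx // ltnW.
Qed.

(** [J] follows registers that the body itself changes and that the frame condition would forget,
    such as the shifted code in [EmitCode] and the row offset in [ForStep]. *)
Lemma emits_for_inv (J : nat -> memory -> Prop) x e body b B (g : nat -> seq nat) ms a p M :
  x \notin ms -> a \in ms -> p \in ms ->
  (forall M1, agree (x :: ms) M M1 -> eval M1 e = b) ->
  J 0 (update M x 0 0) ->
  (forall i M1, i < b -> agree (x :: ms) M M1 -> M1 x 0 = i -> J i M1 ->
     forall s, stream M1 a p s ->
     runs body M1 B (fun M2 =>
       [/\ agree ms M1 M2, stream M2 a p (s ++ g i) & J i.+1 (update M2 x 0 i.+1)])) ->
  emits (x :: ms) a p (For x e body) (for_cost e b B)
    (flatten [seq g i | i <- iota 0 b]) M.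
Proof.
move=> x_ms a_ms p_ms bound J0 step s0 st0.
have ne_ax : a != x by apply: contraNneq x_ms => <-.
have ne_px : p != x by apply: contraNneq x_ms => <-.
have stream_upd M1 v s : stream M1 a p s -> stream (update M1 x 0 v) a p s.
  by move=> [sz st]; split=> [|j]; rewrite /update ?(negbTE ne_ax) ?(negbTE ne_px) /= ?sz.
pose Inv i M1 := [/\ agree (x :: ms) M M1,
  stream M1 a p (s0 ++ flatten [seq g j | j <- iota 0 i]) & J i M1].
suff: runs (For x e body) M (for_cost e b B) (Inv b).
  by move=> h; apply: runs_weaken h (leqnn _) _ => M' [].
apply: runs_for => [|i M1 [/bound]|i M1 lt_i [ag st j_i] x_i] //.
  split=> //; first by apply: agree_update; rewrite ?mem_head.
  by rewrite cats0; apply: stream_upd.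
apply: runs_weaken (step i M1 lt_i ag x_i j_i _ st) (leqnn _) _ => M2 [ag2 st2 j2].
split; first by rewrite ag2.
split=> //.
  apply: agree_update; rewrite ?mem_head //; apply: agree_trans ag _.
  by apply: agree_sub ag2 => y; rewrite inE orbC => ->.
by apply: stream_upd; rewrite -addn1 iotaD map_cat flatten_cat /= cats0 catA.
Qed.

Lemma emits_for x e body b B (g : nat -> seq nat) ms a p M :
  x \notin ms -> a \in ms -> p \in ms ->
  (forall M1, agree (x :: ms) M M1 -> eval M1 e = b) ->
  (forall i M1, i < b -> agree (x :: ms) M M1 -> M1 x 0 = i ->
     emits ms a p body B (g i) M1) ->
  emits (x :: ms) a p (For x e body) (for_cost e b B)
    (flatten [seq g i | i <- iota 0 b]) M.
Proof.
move=> x_ms a_ms p_ms bound step.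
apply: (@emits_for_inv (fun _ _ => True)) => // i M1 lt_i ag x_i _ s st.
by apply: runs_weaken (step i M1 lt_i ag x_i s st) (leqnn _) _ => M2 [].
Qed.

Definition Assign (l : seq (nat * expr)) : cmd :=
  foldr (fun xe c => Seq (SetReg xe.1 xe.2) c) Skip l.

Definition assign (M : memory) (l : seq (nat * expr)) : memory :=
  foldl (fun M' xe => update M' xe.1 0 (eval M' xe.2)) M l.

Definition assign_cost (l : seq (nat * expr)) : nat :=
  foldr (fun xe t => (ecost xe.2).+2 + t) 1 l.

Lemma runs_assign l M (Q : memory -> Prop) :
  Q (assign M l) -> runs (Assign l) M (assign_cost l) Q.
Proof.
elim: l M => [|[x e] l IH] M q /=; first exact: runs_skip.
apply: (runs_seq (Q1 := fun M' => M' = update M x 0 (eval M e))).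
  exact: runs_store.
by move=> _ ->; apply: IH.
Qed.

Lemma agree_assign ms M M' l :
  all (fun xe => xe.1 \in ms) l -> agree ms M M' -> agree ms M (assign M' l).
Proof.
by elim: l M' => //= [[x e] l] IH M' /andP[x_ms /IH h] ag; apply/h/agree_update.
Qed.

Lemma nth_flatten_uniform (T : Type) (x0 : T) (ss : seq (seq T)) k i r :
  all (fun s => size s == k) ss -> r < k -> i < size ss ->
  nth x0 (flatten ss) (i * k + r) = nth x0 (nth [::] ss i) r.
Proof.
move=> + lt_r; elim: ss i => //= s ss IH [|i] /andP[/eqP sz_s sz_ss] lt_i; rewrite nth_cat sz_s.
  by rewrite lt_r.
by rewrite mulSn -addnA ltnNge leq_addr /= addKn IH.
Qed.

(** * The program *)

(* Arrays a*, stream lengths p* of these arrays, scalars r*, and the offsets pu and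
   pv of two rows of the incidence matrix. *)
Local Notation aIn := 0 (only parsing).
Local Notation aOut := 1 (only parsing).
Local Notation aLit := 2 (only parsing).
Local Notation aInc := 3 (only parsing).
Local Notation pLit := 4 (only parsing).
Local Notation pInc := 5 (only parsing).
Local Notation pOut := 6 (only parsing).
Local Notation rn := 7 (only parsing).
Local Notation rm := 8 (only parsing).
Local Notation rPow := 9 (only parsing).
Local Notation rL := 10 (only parsing).
Local Notation rT := 11 (only parsing).
Local Notation rN := 12 (only parsing).
Local Notation rW := 13 (only parsing).
Local Notation rV := 14 (only parsing).
Local Notation rD := 15 (only parsing).
Local Notation rx := 16 (only parsing).
Local Notation rt := 17 (only parsing).
Local Notation ri := 18 (only parsing).
Local Notation rj := 19 (only parsing).
Local Notation rAcc := 20 (only parsing).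
Local Notation pu := 21 (only parsing).
Local Notation pv := 22 (only parsing).

(** * Boolean expressions and output of coded rows *)

Definition bits (s : seq bool) : seq nat := [seq nat_of_bool b | b <- s].

(** Truth values are 0 and 1. Halving a sum of two such values is conjunction, and a double [Not]
    turns any nonzero number into 1. *)
Definition Not (e : expr) : expr := Sub (Const 1) e.
Definition And (e1 e2 : expr) : expr := Half (Add e1 e2).
Definition Or (e1 e2 : expr) : expr := Not (And (Not e1) (Not e2)).
Definition Lt (e1 e2 : expr) : expr := Not (Not (Sub e2 e1)).
Definition Eq (e1 e2 : expr) : expr := Not (Add (Sub e1 e2) (Sub e2 e1)).
Definition Odd (e : expr) : expr := Sub e (Add (Half e) (Half e)).

Lemma eval_Not M e b : eval M e = nat_of_bool b -> eval M (Not e) = nat_of_bool (~~ b).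
Proof. by move=> /= ->; case: b. Qed.

Lemma eval_And M e1 e2 b1 b2 : eval M e1 = nat_of_bool b1 -> eval M e2 = nat_of_bool b2 ->
  eval M (And e1 e2) = nat_of_bool (b1 && b2).
Proof. by move=> /= -> ->; case: b1; case: b2. Qed.

Lemma eval_Or M e1 e2 b1 b2 : eval M e1 = nat_of_bool b1 -> eval M e2 = nat_of_bool b2 ->
  eval M (Or e1 e2) = nat_of_bool (b1 || b2).
Proof. by move=> /= -> ->; case: b1; case: b2. Qed.

Lemma eval_Lt M e1 e2 : eval M (Lt e1 e2) = nat_of_bool (eval M e1 < eval M e2).
Proof. by rewrite /=; case: ltnP => /= ?; lia. Qed.

Lemma eval_Eq M e1 e2 : eval M (Eq e1 e2) = nat_of_bool (eval M e1 == eval M e2).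
Proof. by rewrite /=; case: eqP => /= ?; lia. Qed.

(** Whether a code is present depends only on its place in the table, so this is resolved in the
    program text and not at run time. *)
Definition bit1 (o : option expr) : expr := if o is Some _ then Odd (Reg rx) else Const 0.
Definition bit0 (o : option expr) : expr :=
  if o is Some _ then Not (Odd (Reg rx)) else Const 0.

Definition EmitCode (o : option expr) : cmd :=
  Seq (SetReg rx (odflt (Const 0) o))
    (For rt (Reg rL) (Seq (Emit aInc pInc (bit1 o))
       (Seq (Emit aInc pInc (bit0 o)) (SetReg rx (Half (Reg rx)))))).

(** Brings the recursion into the shape of the output of a [For] loop that halves the code at each
    turn. *)
Lemma codebits_flatten L c : codebits L c =
  flatten [seq (if iter t (omap half) c is Some x then [:: odd x; ~~ odd x]
                else [:: false; false]) | t <- iota 0 L].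
Proof.
elim: L c => //= L IH c; rewrite (iotaDl 1 0) -map_comp IH.
have ->: [seq (if iter t (omap half) (omap half c) is Some x then [:: odd x; ~~ odd x]
                else [:: false; false]) | t <- iota 0 L] =
         [seq ((fun t => if iter t (omap half) c is Some x then [:: odd x; ~~ odd x]
                else [:: false; false]) \o addn 1) t | t <- iota 0 L].
  by apply: eq_map => t /=; rewrite -iterS iterSr.
by case: c => [x|].
Qed.

Definition row_arrays : seq nat := [:: rt; rx; aInc; pInc].

Definition code_cost (E L : nat) : nat := E + 3 + for_cost (Reg rL) L 50.

Lemma emits_code o E L M : M rL 0 = L -> ecost (odflt (Const 0) o) <= E ->
  emits row_arrays aInc pInc (EmitCode o) (code_cost E L)
    (bits (codebits L (omap (eval M) o))) M.
Proof.
move=> M_L le_E s0 st0.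
pose x0 := eval M (odflt (Const 0) o).
pose Q1 (M1 : memory) := M1 = update M rx 0 x0.
apply: (@runs_le _ _ (E + 3 + for_cost (Reg rL) L 50)) => //.
apply: (runs_seq (Q1 := Q1)).
  by apply: (@runs_le _ _ (ecost (Const 0) + ecost (odflt (Const 0) o)).+1) => [|]; [rewrite /=; lia | apply: runs_store].
move=> _ ->; set M1 := update M rx 0 x0.
have ag1 : agree row_arrays M M1 by apply: agree_update.
have st1 : stream M1 aInc pInc s0 by apply: stream_agree st0; last exact: (@agree_update [:: rx]).
pose J t (M2 : memory) := M2 rx 0 = iter t half x0.
have iter_o t : iter t (omap half) (omap (eval M) o) = if o is Some _ then Some (iter t half x0) else None.
  by rewrite /x0; case: (o) => [e|]; elim: t => //= t ->.
pose g t := if o is Some _ then [:: nat_of_bool (odd (iter t half x0));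
  nat_of_bool (~~ odd (iter t half x0))] else [:: 0; 0].
have ->: bits (codebits L (omap (eval M) o)) = flatten [seq g t | t <- iota 0 L].
  rewrite codebits_flatten /bits map_flatten -map_comp; congr flatten.
  by apply: eq_map => t; rewrite /= iter_o /g; case: (o).
suff em : emits row_arrays aInc pInc (For rt (Reg rL) (Seq (Emit aInc pInc (bit1 o))
       (Seq (Emit aInc pInc (bit0 o)) (SetReg rx (Half (Reg rx)))))) (for_cost (Reg rL) L 50)
   (flatten [seq g t | t <- iota 0 L]) M1.
  apply: runs_weaken (em _ st1) (leqnn _) _ => M' [ag st].
  by split=> //; apply: agree_trans ag1 ag.
apply: (@emits_for_inv J) => // [M2 ag|t M2 lt_t ag2 M2t M2x s st].
  by rewrite /= ag // /M1 /update.
have ev1 M3 : M3 rx 0 = iter t half x0 ->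
    eval M3 (bit1 o) = (if o is Some _ then odd (iter t half x0) else false).
  by move=> M3x; case: (o) => [e|]; rewrite /= ?M3x; [case: odd (odd_double_half (iter t half x0)) => /=; lia|].
have ev0 M3 : M3 rx 0 = iter t half x0 ->
    eval M3 (bit0 o) = (if o is Some _ then ~~ odd (iter t half x0) else false).
  by move=> M3x; case: (o) => [e|]; rewrite /= ?M3x; [case: odd (odd_double_half (iter t half x0)) => /=; lia|].
have em1 := @emits_emit [:: aInc; pInc] aInc pInc _ _ M2 isT isT isT (ev1 _ M2x).
apply: (@runs_le _ _ (ecost (bit1 o) + 9 + (ecost (bit0 o) + 9 + 5))).
  by case: (o) => [e|].
apply: runs_seq (em1 _ st) _ => M3 [ag3 st3].
have M3x : M3 rx 0 = iter t half x0 by rewrite ag3.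
have em0 := @emits_emit [:: aInc; pInc] aInc pInc _ _ M3 isT isT isT (ev0 _ M3x).
apply: runs_seq (em0 _ st3) _ => M4 [ag4 st4].
have M4x : M4 rx 0 = iter t half x0 by rewrite ag4.
apply: runs_store; split.
- apply: agree_update => //; apply: agree_trans (agree_sub _ ag3) (agree_sub _ ag4);
  by move=> y y_ms; rewrite inE y_ms orbT.
- apply: (@stream_agree [:: rx] M4) => //; first exact: agree_update.
  by move: st4; rewrite -catA /g; case: (o).
- by rewrite /J /update /= M4x.
Qed.

Definition EmitRow (es : seq (option expr)) : cmd :=
  foldr (fun o c => Seq (EmitCode o) c) Skip es.

Definition row_cost (L k : nat) : nat := k * code_cost 20 L + 1.

Definition fixed_on (ms : seq nat) (e : expr) : bool := all (fun a => a \notin ms) (arrays e).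

(** The entries may read only arrays that are not written while a row is output, so each of them
    keeps its value in [M] until its turn. *)
Lemma emits_row es L M : M rL 0 = L ->
  all (fun o => ecost (odflt (Const 0) o) <= 20) es ->
  all (fun o => fixed_on row_arrays (odflt (Const 0) o)) es ->
  emits row_arrays aInc pInc (EmitRow es) (row_cost L (size es))
    (bits (row L [seq omap (eval M) o | o <- es])) M.
Proof.
elim: es M => [|o es IH] M M_L /=; first by move=> _ _; apply: emits_skip.
move=> /andP[cost_o cost_es] /andP[fix_o fix_es].
rewrite /row_cost mulSn -addnA /row /= /bits map_cat.
apply: emits_seq; first exact: emits_code.
move=> M' ag; have -> : [seq omap (eval M) o | o <- es] = [seq omap (eval M') o | o <- es].
  elim: (es) fix_es => //= -[e|] es' IHe /andP[fix_e /IHe ->] //=.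
  by rewrite (eval_agree fix_e ag).
by apply: IH => //; rewrite ag.
Qed.

(** Evaluating the table of expressions gives the table of codes. *)
Lemma map_cls_codes (T U : Type) (f : T -> U) zero k nk zero' k' nk' s :
  f zero = zero' -> (forall r, r < 3 -> f (k r) = k' r) ->
  (forall r, r < 3 -> f (nk r) = nk' r) ->
  [seq omap f o | o <- cls_codes zero k nk s] = cls_codes zero' k' nk' s.
Proof. by move=> fz fk fn; case: s => [|[|[|s]]] /=; rewrite ?fz !fk ?fn. Qed.

(** Disjoint from everything that [environment] reads, so the environment survives all later
    phases. *)
Definition work_arrays : seq nat :=
  [:: ri; rj; rt; rx; aInc; pInc; aOut; pOut; rAcc; pu; pv].

(** * Output of the incidence matrix and of the adjacency matrix *)

Section Phases.

Variables (n : nat) (Cs : seq (seq nat)).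
Hypothesis Cs3 : all (fun C => size C == 3) Cs.

Let m := size Cs.
Let L := code_length n.
Let T := (2 ^ L).-1.
Let N := num_forced n.
Let ws := vertex_rows n Cs.
Let rows := all_rows N ws.
Let V := size ws + N.+2.

(** The parameters and tables available after the set-up. In [env_cls], the offset 2 skips the two
    counts at the start of the input, and each clause takes three cells. *)
Record environment (M : memory) : Prop := Environment {
  env_n : M rn 0 = n;
  env_m : M rm 0 = m;
  env_L : M rL 0 = L;
  env_T : M rT 0 = T;
  env_N : M rN 0 = N;
  env_W : M rW 0 = size ws;
  env_V : M rV 0 = V;
  env_D : M rD 0 = n.*2;
  env_lit : forall e, e < n.*2 -> M aLit e = lit_code T e;
  env_cls : forall j r, j < m -> r < 3 -> M aIn (2 + (j * 3 + r)) = nth 0 (nth [::] Cs j) r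
}.

Hypothesis Cs_lt : forall j r, j < m -> r < 3 -> nth 0 (nth [::] Cs j) r < n.*2.

Lemma env_agree ms M M' :
  agree ms M M' -> environment M -> all (fun a => a \in work_arrays) ms -> environment M'.
Proof.
move=> ag0 [? ? ? ? ? ? ? ? lit cls] /allP sub; have ag := agree_sub sub ag0.
by split=> [||||||||e lt_e|j r lt_j lt_r]; rewrite ag // ?lit ?cls.
Qed.

Definition clause_key (r : nat) : expr :=
  Get aLit (Get aIn (Add (Const (2 + r)) (Add (Reg rj) (Add (Reg rj) (Reg rj))))).

Definition ClauseRow (s : nat) : cmd :=
  EmitRow (cls_codes (Const 0) clause_key (fun r => Sub (Reg rT) (clause_key r)) s).

Let R (v : vertex) : seq nat := bits (row L (vertex_codes n T v)).

Lemma emits_clause_row s M j : s < 3 -> environment M -> j < m -> M rj 0 = j ->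
  emits row_arrays aInc pInc (ClauseRow s) (row_cost L 19) (bits (row L (vertex_codes n T (Cls (nth [::] Cs j) s)))) M.
Proof.
move=> lt_s env lt_j M_j.
have key r : r < 3 -> eval M (clause_key r) = lit_code T (nth 0 (nth [::] Cs j) r).
  move=> lt_r; rewrite /clause_key /= M_j.
  have ->: 2 + r + (j + (j + j)) = 2 + (j * 3 + r) by lia.
  by rewrite (env_cls env) // (env_lit env) // Cs_lt.
have <- : [seq omap (eval M) o | o <- cls_codes (Const 0) clause_key
    (fun r => Sub (Reg rT) (clause_key r)) s] = vertex_codes n T (Cls (nth [::] Cs j) s).
  apply: map_cls_codes => // r lt_r; rewrite -key //.
  by rewrite -[in RHS](env_T env).
have -> : row_cost L 19 = row_cost L (size (cls_codes (Const 0) clause_key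
  (fun r => Sub (Reg rT) (clause_key r)) s)).
  by case: s lt_s => [|[|[|]]].
by apply: emits_row; rewrite ?(env_L env) //; case: s lt_s => [|[|[|]]].
Qed.

Definition LitRows : cmd := For ri (Reg rD) (EmitRow (lit_codes (Get aLit (Reg ri)))).

Definition ClauseRows : cmd :=
  For rj (Reg rm) (Seq (ClauseRow 0) (Seq (ClauseRow 1) (ClauseRow 2))).

Definition PaletteRow (s : nat) : cmd := EmitRow (pal_codes (Const 0) (Reg rn) s).

Definition OnesRow : cmd := For ri (Reg rN) (Emit aInc pInc (Const 1)).

Definition UnitRows : cmd :=
  For ri (Reg rN) (For rj (Reg rN) (Emit aInc pInc (Eq (Reg rj) (Reg ri)))).

(** Follows the order of [all_rows]. A row of 19 absent codes is the zero row of [p], as it has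
    exactly [N] entries. *)
Definition Rows : cmd :=
  Seq LitRows (Seq ClauseRows (Seq (PaletteRow 0) (Seq (PaletteRow 1) (Seq (PaletteRow 2)
    (Seq (EmitRow (nseq 19 None)) (Seq OnesRow UnitRows)))))).

Definition rows_arrays : seq nat := ri :: rj :: row_arrays.

Lemma bits_cat s1 s2 : bits (s1 ++ s2) = bits s1 ++ bits s2.
Proof. exact: map_cat. Qed.

Lemma bits_flatten ss : bits (flatten ss) = flatten [seq bits s | s <- ss].
Proof. exact: map_flatten. Qed.

Lemma vertex_list_output (rho : vertex -> seq bool) :
  bits (flatten [seq rho v | v <- vertex_list n Cs]) =
  flatten [seq bits (rho (Lit e)) | e <- iota 0 n.*2] ++
  flatten [seq bits (rho (Cls (nth [::] Cs j) 0)) ++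
     bits (rho (Cls (nth [::] Cs j) 1)) ++ bits (rho (Cls (nth [::] Cs j) 2)) | j <- iota 0 m] ++
  bits (rho (Pal 0)) ++ bits (rho (Pal 1)) ++ bits (rho (Pal 2)).
Proof.
have clsE : bits (flatten [seq rho v | v <- flatten [seq [seq Cls C s | s <- iota 0 3] | C <- Cs]]) =
    flatten [seq bits (rho (Cls (nth [::] Cs j) 0)) ++
     bits (rho (Cls (nth [::] Cs j) 1)) ++ bits (rho (Cls (nth [::] Cs j) 2)) | j <- iota 0 m].
  rewrite -[in LHS](mkseq_nth [::] Cs) /mkseq -/m.
  by elim: (iota 0 m) => //= j js IH; rewrite !bits_cat IH -!catA.
rewrite /vertex_list !map_cat !flatten_cat !bits_cat clsE.
by rewrite bits_flatten -!map_comp /= cats0.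
Qed.

Lemma rows_output :
  flatten [seq R (Lit e) | e <- iota 0 n.*2] ++
  flatten [seq R (Cls (nth [::] Cs j) 0) ++ R (Cls (nth [::] Cs j) 1) ++ R (Cls (nth [::] Cs j) 2)
          | j <- iota 0 m] ++
  R (Pal 0) ++ R (Pal 1) ++ R (Pal 2) ++ bits (row L (nseq 19 None)) ++
  flatten [seq [:: 1] | _ <- iota 0 N] ++
  flatten [seq flatten [seq [:: nat_of_bool (f == g)] | f <- iota 0 N] | g <- iota 0 N]
  = bits (flatten rows).
Proof.
have zeros : row L (nseq 19 None) = nseq N false.
  have codes0 : codebits L None = nseq L.*2 false by elim: L => //= k ->.
  rewrite /row map_nseq codes0 /N /num_forced -/L.
  by elim: 19 => // k IH; rewrite mulSn nseqD -IH.
have ones : flatten [seq [:: 1] | _ <- iota 0 N] = bits (nseq N true).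
  rewrite flatten_map1 -[in RHS](size_iota 0 N).
  by elim: (iota 0 N) => //= k ks ->.
have units : flatten [seq flatten [seq [:: nat_of_bool (f == g)] | f <- iota 0 N] | g <- iota 0 N]
    = bits (flatten [seq [seq f == g | f <- iota 0 N] | g <- iota 0 N]).
  rewrite bits_flatten -map_comp; congr flatten; apply: eq_map => g /=.
  by rewrite flatten_map1 /bits -map_comp.
rewrite zeros ones units /rows /all_rows flatten_cat bits_cat vertex_list_output.
have flatten_cons (s : seq bool) ss : flatten (s :: ss) = s ++ flatten ss by [].
rewrite (flatten_cons (nseq N false)) (flatten_cons (nseq N true)).
move: (flatten [seq [seq f == g | f <- iota 0 N] | g <- iota 0 N]) => us.
move: (nseq N false) (nseq N true) => zs os.
by rewrite (bits_cat zs) (bits_cat os) -!catA.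
Qed.

Definition rows_cost : nat :=
  for_cost (Reg rD) n.*2 (row_cost L 19) +
  (for_cost (Reg rm) m (row_cost L 19 + (row_cost L 19 + row_cost L 19)) +
  (row_cost L 19 + (row_cost L 19 + (row_cost L 19 + (row_cost L 19 +
  (for_cost (Reg rN) N 50 + for_cost (Reg rN) N (for_cost (Reg rN) N 50))))))).

Lemma emits_palette s M : environment M -> s < 3 ->
  emits row_arrays aInc pInc (PaletteRow s) (row_cost L 19) (R (Pal s)) M.
Proof.
move=> env lt_s.
have -> : R (Pal s) = bits (row L [seq omap (eval M) o | o <- pal_codes (Const 0) (Reg rn) s]).
  by case: s lt_s => [|[|[|]]] //= _; rewrite (env_n env).
have -> : row_cost L 19 = row_cost L (size (pal_codes (Const 0) (Reg rn) s)).
  by case: s lt_s => [|[|[|]]].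
by apply: emits_row; rewrite ?(env_L env) //; case: s lt_s => [|[|[|]]].
Qed.

Lemma emits_rows M : environment M ->
  emits rows_arrays aInc pInc Rows rows_cost (bits (flatten rows)) M.
Proof.
move=> env; rewrite -rows_output /rows_cost.
have next M1 : agree rows_arrays M M1 -> environment M1 by move=> ag; exact: (env_agree ag env).
have sub_row : {subset row_arrays <= rows_arrays} by exact/allP.
have step c1 c2 T1 T2 s1 s2 :
    (forall M1, environment M1 -> emits rows_arrays aInc pInc c1 T1 s1 M1) ->
    (forall M1, environment M1 -> emits rows_arrays aInc pInc c2 T2 s2 M1) ->
    forall M1, environment M1 -> emits rows_arrays aInc pInc (Seq c1 c2) (T1 + T2) (s1 ++ s2) M1.
  move=> em1 em2 M1 env1; apply: emits_seq; first exact: em1.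
  by move=> M2 ag; apply: em2; exact: (env_agree ag env1).
have rowstep c T1 s : (forall M1, environment M1 -> emits row_arrays aInc pInc c T1 s M1) ->
    forall M1, environment M1 -> emits rows_arrays aInc pInc c T1 s M1.
  by move=> em M1 /em h; apply: emits_weaken h sub_row (leqnn _).
move: M env {next}; apply: (step) => [M env|].
  apply: (@emits_weaken (ri :: row_arrays)) (leqnn _) => //; last exact/allP.
  apply: emits_for => // [M1 ag|e M1 lt_e ag M1_e]; have env1 := env_agree ag env isT.
    by rewrite /= (env_D env1).
  have := @emits_row (lit_codes (Get aLit (Reg ri))) L M1 (env_L env1) isT isT.
  by rewrite /R /= M1_e (env_lit env1).
apply: (step) => [M env|].
  apply: (@emits_weaken (rj :: row_arrays)) (leqnn _) => //; last exact/allP.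
  apply: emits_for => // [M1 ag|j M1 lt_j ag M1_j]; have env1 := env_agree ag env isT.
    by rewrite /= (env_m env1).
  apply: emits_seq => [|M2 ag2]; first exact: emits_clause_row.
  have env2 := env_agree ag2 env1 isT.
  have M2_j : M2 rj 0 = j by rewrite ag2.
  apply: emits_seq => [|M3 ag3]; first exact: emits_clause_row.
  have env3 := env_agree ag3 env2 isT.
  by apply: emits_clause_row => //; rewrite ag3.
apply: (step); first by apply: (rowstep) => M env; apply: emits_palette.
apply: (step); first by apply: (rowstep) => M env; apply: emits_palette.
apply: (step); first by apply: (rowstep) => M env; apply: emits_palette.
apply: (step).
  by apply: (rowstep) => M env; apply: (@emits_row (nseq 19 None) L M (env_L env)).
apply: (step) => M env.
  apply: (@emits_weaken (ri :: row_arrays)) (leqnn _) => //; last exact/allP.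
  apply: emits_for => // [M1 ag|e M1 lt_e ag M1_e]; have env1 := env_agree ag env isT.
    by rewrite /= (env_N env1).
  by apply: (@emits_weaken row_arrays) (emits_emit _ _ _ _) _ _.
apply: emits_for => // [M1 ag|g M1 lt_g ag M1_g]; have env1 := env_agree ag env isT.
  by rewrite /= (env_N env1).
apply: emits_for => // [M2 ag2|f M2 lt_f ag2 M2_f]; have env2 := env_agree ag2 env1 isT.
  by rewrite /= (env_N env2).
apply: (@emits_weaken row_arrays) (emits_emit _ _ _ _) _ _ => //.
by rewrite eval_Eq /= M2_f ag2 // M1_g.
Qed.

(** Keeps [q] at [N] times the counter by repeated addition, in place of a multiplication; [q] is
    the offset of a row in the flattened incidence matrix. *)
Definition ForStep (x q : nat) (e : expr) (body : cmd) : cmd :=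
  Seq (SetReg q (Const 0)) (For x e (Seq body (SetReg q (Add (Reg q) (Reg rN))))).

Definition for_step_cost (e : expr) (b B : nat) : nat := 3 + for_cost e b (B + 7).

Lemma emits_for_step x q e body b B (g : nat -> seq nat) ms a p M :
  x \notin q :: ms -> q \notin ms -> rN \notin x :: q :: ms -> a \in ms -> p \in ms ->
  M rN 0 = N ->
  (forall M1, agree (x :: q :: ms) M M1 -> eval M1 e = b) ->
  (forall i M1, i < b -> agree (x :: q :: ms) M M1 -> M1 x 0 = i -> M1 q 0 = i * N ->
     emits ms a p body B (g i) M1) ->
  emits (x :: q :: ms) a p (ForStep x q e body) (for_step_cost e b B)
    (flatten [seq g i | i <- iota 0 b]) M.
Proof.
move=> x_ms q_ms N_ms a_ms p_ms M_N bound step s0 st0.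
have ne_xq : q == x = false by apply: contraNF x_ms => /eqP <-; rewrite mem_head.
have ne_aq : a == q = false by apply: contraNF q_ms => /eqP <-.
have ne_pq : p == q = false by apply: contraNF q_ms => /eqP <-.
have stream_upd M1 v s : stream M1 a p s -> stream (update M1 q 0 v) a p s.
  by move=> [sz st]; split=> [|j]; rewrite /update ?ne_aq ?ne_pq /= ?sz.
have q_in : q \in x :: q :: ms by rewrite !inE eqxx orbT.
apply: (runs_seq (Q1 := fun M1 => M1 = update M q 0 0)); first exact: runs_store.
move=> _ ->; set M1 := update M q 0 0.
have ag1 : agree (x :: q :: ms) M M1 by apply: agree_update.
pose J i (M2 : memory) := M2 q 0 = i * N.
suff em : emits (x :: q :: ms) a p (For x e (Seq body (SetReg q (Add (Reg q) (Reg rN)))))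
    (for_cost e b (B + 7)) (flatten [seq g i | i <- iota 0 b]) M1.
  apply: runs_weaken (em _ (stream_upd _ _ _ st0)) (leqnn _) _ => M2 [ag2 st2].
  by split=> //; apply: agree_trans ag1 ag2.
apply: (@emits_for_inv J); rewrite ?inE ?a_ms ?p_ms ?orbT //.
- by move=> M2 ag2; apply: bound; apply: agree_trans ag1 ag2.
- by rewrite /J /M1 /update ne_xq /= eqxx.
move=> i M2 lt_i ag2 M2_x M2_q s st2.
have ag02 := agree_trans ag1 ag2.
have h := step i M2 lt_i ag02 M2_x M2_q s st2.
apply: runs_seq h _ => M3 [ag3 st3].
have M3_N : M3 rN 0 = N.
  rewrite ag3; last by apply: contra N_ms; rewrite !inE => ->; rewrite !orbT.
  by rewrite ag02.
apply: (@runs_le _ _ (ecost (Const 0) + ecost (Add (Reg q) (Reg rN))).+1) => //.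
apply: runs_store; split.
- apply: agree_update; rewrite ?mem_head //.
  by apply: agree_sub ag3 => y y_ms; rewrite inE y_ms orbT.
- exact: stream_upd.
- rewrite /J /update ne_xq /= eqxx M3_N ag3 // M2_q mulSn addnC //.
Qed.

Definition entry_expr : expr :=
  And (Not (Eq (Reg ri) (Reg rj)))
    (Or (And (Eq (Reg ri) (Reg rW)) (Lt (Reg rj) (Reg rW)))
    (Or (And (Eq (Reg rj) (Reg rW)) (Lt (Reg ri) (Reg rW)))
        (Lt (Const 0) (Reg rAcc)))).

(** [rAcc] counts the sets that contain both vertices; [entry_expr] then evaluates [row_adj],
    reading the overlap off as a positive count. *)
Definition Entry : cmd :=
  Seq (Seq (SetReg rAcc (Const 0))
         (For rt (Reg rN) (SetReg rAcc (Add (Reg rAcc)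
            (And (Get aInc (Add (Reg pu) (Reg rt))) (Get aInc (Add (Reg pv) (Reg rt))))))))
      (Emit aOut pOut entry_expr).

Definition entry_arrays : seq nat := [:: rt; rAcc; aOut; pOut].

Definition entry_cost : nat := 3 + for_cost (Reg rN) N 30 + 200.

Lemma nth_bits s i : nth 0 (bits s) i = nat_of_bool (nth false s i).
Proof.
have [lt_i|ge_i] := ltnP i (size s); first by rewrite (nth_map false).
by rewrite !nth_default ?size_map.
Qed.

Lemma emits_entry M u v : environment M ->
  (forall i, M aInc i = nth 0 (bits (flatten rows)) i) ->
  u < V -> v < V -> M ri 0 = u -> M rj 0 = v -> M pu 0 = u * N -> M pv 0 = v * N ->
  emits entry_arrays aOut pOut Entry entry_cost [:: nat_of_bool (row_adj N ws u v)] M.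
Proof.
move=> env M_inc lt_u lt_v M_u M_v M_pu M_pv s0 st0.
have rows_sz := all_rows_size (@size_vertex_rows n Cs); rewrite -/N -/ws -/rows in rows_sz.
have sz_rows : size rows = V by exact: size_all_rows.
have inc x f : x < V -> f < N -> M aInc (x * N + f) = nat_of_bool (nth false (nth [::] rows x) f).
  by move=> lt_x lt_f; rewrite M_inc nth_bits nth_flatten_uniform // sz_rows.
pose common f := nth false (nth [::] rows u) f && nth false (nth [::] rows v) f.
pose Inv f (M1 : memory) :=
  agree [:: rt; rAcc] M M1 /\ (0 < M1 rAcc 0) = has common (iota 0 f).
have acc : runs (Seq (SetReg rAcc (Const 0))
         (For rt (Reg rN) (SetReg rAcc (Add (Reg rAcc)
            (And (Get aInc (Add (Reg pu) (Reg rt))) (Get aInc (Add (Reg pv) (Reg rt))))))))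
   M (3 + for_cost (Reg rN) N 30) (Inv N).
  apply: (runs_seq (Q1 := fun M1 => M1 = update M rAcc 0 0)); first exact: runs_store.
  move=> _ ->; apply: runs_for => [|f M1 [ag _] _|f M1 lt_f [ag acc_f] M1_f].
  - by split=> //; do 2 apply: agree_update => //.
  - by rewrite /= ag // (env_N env).
  apply: (@runs_le _ _ (ecost (Const 0) + ecost (Add (Reg rAcc)
    (And (Get aInc (Add (Reg pu) (Reg rt))) (Get aInc (Add (Reg pv) (Reg rt)))))).+1) => //.
  apply: runs_store; split; first by rewrite /update /= M1_f.
  split; first by do 2 apply: agree_update => //.
  rewrite -[f.+1]addn1 iotaD has_cat -acc_f /update /= orbF.
  have -> : M1 aInc (M1 pu 0 + M1 rt 0) = nat_of_bool (nth false (nth [::] rows u) f).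
    by rewrite M1_f !ag // M_pu inc.
  have -> : M1 aInc (M1 pv 0 + M1 rt 0) = nat_of_bool (nth false (nth [::] rows v) f).
    by rewrite M1_f !ag // M_pv inc.
  by rewrite addn_gt0 /common; do 2 case: (nth false _ f).
apply: runs_seq acc _ => M1 [ag1 acc1].
have em := @emits_emit entry_arrays aOut pOut entry_expr (nat_of_bool (row_adj N ws u v)) M1
  isT isT isT _.
have st1 : stream M1 aOut pOut s0 by apply: stream_agree ag1 st0.
apply: (@runs_le _ _ (ecost entry_expr + 9)) => //.
apply: runs_weaken (em _ _ st1) (leqnn _) _ => [|M2 [ag2 st2]].
  have reg r : r \notin [:: rt; rAcc] -> eval M1 (Reg r) = M r 0 by move=> h; rewrite /= ag1.
  rewrite /row_adj (overlap_nth (N := N)) -/rows ?(size_nth_rows (@size_vertex_rows n Cs)) //.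
  rewrite -[has _ _]acc1.
  apply: eval_And; first by apply: eval_Not; rewrite eval_Eq !reg // M_u M_v.
  apply: eval_Or.
    by apply: eval_And; rewrite (eval_Eq, eval_Lt) !reg // (env_W env) ?M_u ?M_v.
  apply: eval_Or; last by rewrite eval_Lt.
  by apply: eval_And; rewrite (eval_Eq, eval_Lt) !reg // (env_W env) ?M_u ?M_v.
by split=> //; apply: agree_trans ag2; apply: agree_sub ag1; exact/allP.
Qed.

Definition Matrix : cmd := ForStep ri pu (Reg rV) (ForStep rj pv (Reg rV) Entry).

Definition matrix_arrays : seq nat := ri :: pu :: rj :: pv :: entry_arrays.

Definition matrix_cost : nat :=
  for_step_cost (Reg rV) V (for_step_cost (Reg rV) V entry_cost).

Lemma emits_matrix M : environment M ->
  (forall i, M aInc i = nth 0 (bits (flatten rows)) i) ->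
  emits matrix_arrays aOut pOut Matrix matrix_cost
    (flatten [seq flatten [seq [:: nat_of_bool (row_adj N ws u v)] | v <- iota 0 V] | u <- iota 0 V]) M.
Proof.
move=> env M_inc; apply: emits_for_step => // [|M1 ag1|u M1 lt_u ag1 M1_u M1_pu].
- exact: env_N env.
- by rewrite /= (env_V (env_agree ag1 env isT)).
have env1 := env_agree ag1 env isT.
apply: emits_for_step => // [|M2 ag2|v M2 lt_v ag2 M2_v M2_pv].
- exact: env_N env1.
- by rewrite /= (env_V (env_agree ag2 env1 isT)).
apply: emits_entry => //; first exact: (env_agree ag2 env1 isT).
- by move=> i; rewrite ag2 // ag1.
- by rewrite ag2.
- by rewrite ag2.
Qed.

End Phases.

(** * The complete program *)

Lemma size_vertex_rows_list n Cs : size (vertex_rows n Cs) = n.*2 + (size Cs * 3 + 3).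
Proof.
rewrite size_map !size_cat !size_map !size_iota size_flatten /shape -map_comp.
by congr (_ + (_ + _)); elim: Cs => //= C Cs ->.
Qed.

Definition Times (k : nat) (e : expr) : expr := iter k (Add e) (Const 0).

Lemma eval_Times M k e : eval M (Times k e) = k * eval M e.
Proof. by elim: k => //= k ->; rewrite mulSn. Qed.

Definition ReadInput : cmd :=
  Assign [:: (rn, Get aIn (Const 0)); (rm, Get aIn (Const 1)); (rPow, Const 1)].

(** Doubles [rPow] as long as it is at most [n]; [n] turns are more than enough and keep the loop
    bounded in advance. *)
Definition PowerLoop : cmd :=
  For ri (Reg rn) (If (Sub (Add (Reg rn) (Const 1)) (Reg rPow))
    (Assign [:: (rPow, Add (Reg rPow) (Reg rPow)); (rL, Add (Reg rL) (Const 1))]) Skip).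

(** Assigned in this order, later entries using earlier ones. The power and the exponent found by
    the loop are raised by one more step to reach [code_length]; 38 is two sets per bit at 19
    coordinates. *)
Definition size_exprs : seq (nat * expr) :=
  [:: (rT, Sub (Add (Reg rPow) (Reg rPow)) (Const 1)); (rL, Add (Reg rL) (Const 1));
      (rD, Add (Reg rn) (Reg rn)); (rN, Times 38 (Reg rL));
      (rW, Add (Reg rD) (Add (Times 3 (Reg rm)) (Const 3)));
      (rV, Add (Reg rW) (Add (Reg rN) (Const 2)))].

(** Variable [i] fills the cells [2i] and [2i + 1], so the table is indexed by the numbers of
    [encode_literal]. *)
Definition LitTable : cmd :=
  For ri (Reg rn) (Seq (Emit aLit pLit (Reg ri)) (Emit aLit pLit (Sub (Reg rT) (Reg ri)))).

Definition Program : cmd :=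
  If (Get aIn (Const 0))
    (Seq ReadInput (Seq PowerLoop (Seq (Assign size_exprs) (Seq LitTable (Seq Rows
      (Seq (Emit aOut pOut (Reg rV)) (Seq (Emit aOut pOut (Add (Reg rN) (Const 4))) Matrix)))))))
    Skip.

Lemma runs_power_loop n M : 0 < n -> M rn 0 = n -> M rPow 0 = 1 -> M rL 0 = 0 ->
  runs PowerLoop M (for_cost (Reg rn) n 50) (fun M' =>
    [/\ agree [:: ri; rPow; rL] M M', M' rPow 0 = 2 ^ (trunc_log 2 n).+1
      & M' rL 0 = (trunc_log 2 n).+1]).
Proof.
move=> n_gt0 M_n M_P M_L.
(* After [n] turns this gives [n < rPow <= 2n], which determines the power of two. *)
pose Inv i (M1 : memory) := [/\ agree [:: ri; rPow; rL] M M1, M1 rPow 0 = 2 ^ M1 rL 0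
  & i < M1 rPow 0 <= n.*2].
apply: (@runs_weaken _ _ (for_cost (Reg rn) n 50) _ (Inv n)) => // [|M' [ag M'_P bounds]].
  apply: runs_for => [|i M1 [ag _ _] _|i M1 lt_i [ag M1_P /andP[lt_P le_P]] M1_i].
  - split; first exact: agree_update.
    + by rewrite /update /= M_P M_L.
    + by rewrite /update /= M_P; lia.
  - by rewrite /= ag.
  have M1_n : M1 rn 0 = n by rewrite ag.
  apply: (@runs_le _ _ (ecost (Sub (Add (Reg rn) (Const 1)) (Reg rPow)) + 30).+1) => //.
  apply: runs_if => cond; rewrite /= M1_n in cond.
    apply: (@runs_le _ _ (assign_cost [:: (rPow, Add (Reg rPow) (Reg rPow)); (rL, Add (Reg rL) (Const 1))])) => //.
    apply: runs_assign; split; first by rewrite /= /update /= M1_i.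
    split; first by apply: agree_update => //; apply: agree_assign.
      by rewrite /= /update /= M1_P addn1 expnS mul2n addnn.
    by rewrite /= /update /=; lia.
  apply: (@runs_le _ _ 1) => //; apply: runs_skip; split=> //.
  split; first exact: agree_update.
  - by rewrite /update /=.
  - by rewrite /update /=; lia.
have P_eq : M' rL 0 = (trunc_log 2 n).+1.
  move: bounds; rewrite M'_P; case: (M' rL 0) => [|l]; first by rewrite expn0; lia.
  rewrite [X in _ < X <= _]expnS => bounds; congr _.+1; symmetry; apply: trunc_log_eq => //.
  by rewrite expnS; lia.
by rewrite M'_P P_eq.
Qed.

Lemma nth_lit_table n T e : e < n.*2 ->
  nth 0 (flatten [seq [:: i; T - i] | i <- iota 0 n]) e = lit_code T e.
Proof.
move=> lt_e; have -> : e = e./2 * 2 + odd e by lia.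
rewrite nth_flatten_uniform ?size_map ?size_iota //; last by lia.
- rewrite (nth_map 0) ?size_iota ?nth_iota /lit_code; try lia.
  have -> : odd (e./2 * 2 + odd e) = odd e by lia.
  have -> : (e./2 * 2 + odd e)./2 = e./2 by lia.
  by case: (odd e).
- by apply/allP => _ /mapP[i _ ->].
- by case: (odd e).
Qed.

Definition total_cost (n : nat) (Cs : seq (seq nat)) : nat :=
  100 + (for_cost (Reg rn) n 50 + (500 + (for_cost (Reg rn) n 50 +
    (rows_cost n Cs + (50 + (50 + matrix_cost n Cs)))))).

Lemma encode_row_graph N q ws :
  encode_ecc (row_graph N ws, q) = [:: size ws + N.+2, q &
    flatten [seq flatten [seq [:: nat_of_bool (row_adj N ws u v)] | v <- iota 0 (size ws + N.+2)]
            | u <- iota 0 (size ws + N.+2)]].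
Proof.
rewrite /encode_ecc /=; congr [:: _, _ & flatten _].
rewrite -val_enum_ord -[in RHS]map_comp; apply: eq_map => u /=.
by rewrite flatten_map1 -[in RHS]map_comp.
Qed.

Lemma runs_program Phi : runs Program (input_memory (encode_cnf3 Phi))
  (total_cost (nvars Phi) (coded_clauses Phi)).+3
  (fun M => outputs M (encode_ecc (reduction Phi))).
Proof.
set n := nvars Phi; set Cs := coded_clauses Phi; set M0 := input_memory _.
have sz_Cs : size Cs = nclauses Phi by rewrite size_map.
have M0_reg a i : a != 0 -> M0 a i = 0 by rewrite /M0 /input_memory => /negbTE ->.
apply: (@runs_le _ _ (ecost (Get aIn (Const 0)) + total_cost n Cs).+1) => //.
apply: runs_if => [|n0]; last first.
  apply: (@runs_le _ _ 1) => //; apply: runs_skip.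
  have {}n0 : nvars Phi == 0 by move/eqP: n0.
  rewrite /reduction n0.
  (* Nothing is written in this case: the output array, still all 0, already reads as this word. *)
  have -> : encode_ecc (empty_graph, 0) = [:: 0; 0].
    by rewrite /encode_ecc /= (size0nil (size_enum_ord 0)).
  by move=> [|[|i]].
move=> n_neq0; have n_gt0 : 0 < n by rewrite lt0n; exact: n_neq0.
have Cs_ok := @coded_clauses_ok Phi; rewrite -/n -/Cs in Cs_ok.
have Cs3 : all (fun C => size C == 3) Cs by apply/allP => C /Cs_ok/andP[].
have Cs_lt j r : j < size Cs -> r < 3 -> nth 0 (nth [::] Cs j) r < n.*2.
  move=> lt_j lt_r; have /Cs_ok/andP[/eqP sz_C /allP lt_C] := mem_nth [::] lt_j.
  by apply/lt_C/mem_nth; rewrite sz_C.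
rewrite /total_cost.
apply: (runs_seq (Q1 := fun M1 => [/\ agree [:: rn; rm; rPow] M0 M1, M1 rn 0 = n,
    M1 rm 0 = size Cs & M1 rPow 0 = 1])).
  apply: (@runs_le _ _ (assign_cost [:: (rn, Get aIn (Const 0)); (rm, Get aIn (Const 1)); (rPow, Const 1)])) => //.
  by apply: runs_assign; split; rewrite ?sz_Cs //; apply: agree_assign.
move=> M1 [ag1 M1_n M1_m M1_P].
have M1_reg a i : a \notin [:: rn; rm; rPow; aIn] -> M1 a i = 0.
  by rewrite !inE !negb_or => /and4P[? ? ? ?]; rewrite ag1 ?M0_reg // !inE !negb_or; apply/and3P.
apply: runs_seq (runs_power_loop n_gt0 M1_n M1_P (M1_reg rL 0 isT)) _ => M2 [ag2 M2_P M2_L].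
set L := code_length n; set T := (2 ^ L).-1; set N := num_forced n.
set ws := vertex_rows n Cs.
apply: (runs_seq (Q1 := fun M3 => [/\ agree [:: rT; rL; rD; rN; rW; rV] M2 M3,
    [/\ M3 rL 0 = L, M3 rT 0 = T & M3 rN 0 = N],
    M3 rD 0 = n.*2, M3 rW 0 = size ws & M3 rV 0 = size ws + N.+2])).
  apply: (@runs_le _ _ (assign_cost size_exprs)) => //; apply: runs_assign.
  have M2_n : M2 rn 0 = n by rewrite ag2.
  have M2_m : M2 rm 0 = size Cs by rewrite ag2.
  have L_eq : L = M2 rL 0 + 1 by rewrite M2_L addn1.
  have N_eq : N = 38 * (M2 rL 0 + 1) by rewrite -L_eq /N /num_forced -/L -muln2 mulnCA mulnC.
  have T_eq : T = M2 rPow 0 + M2 rPow 0 - 1.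
    by rewrite /T /L /code_length expnS M2_P; lia.
  have evN M' : eval M' (Times 38 (Reg rL)) = 38 * M' rL 0 by rewrite eval_Times.
  rewrite /ws size_vertex_rows_list N_eq T_eq L_eq -M2_n -M2_m.
  split; first exact: agree_assign.
  - by split; rewrite /assign /size_exprs /= ?evN /update /=.
  - by rewrite /assign /size_exprs /= /update /= addnn.
  - by rewrite /assign /size_exprs /= /update /=; lia.
  - by rewrite /assign /size_exprs /= /update /=; lia.
move=> M3 [ag3 [M3_L M3_T M3_N] M3_D M3_W M3_V].
have M3_n : M3 rn 0 = n by rewrite ag3 // ag2.
have M3_m : M3 rm 0 = size Cs by rewrite ag3 // ag2.
have M3_reg a i : a \in [:: aOut; aLit; aInc; pLit; pInc; pOut] -> M3 a i = 0.
  by rewrite !inE => /or3P[/eqP->|/eqP->|/or4P[] /eqP->]; rewrite ag3 // ag2 // M1_reg.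
have st_lit : stream M3 aLit pLit [::] by split=> [|i]; rewrite M3_reg ?nth_nil.
have lit_em : emits (ri :: [:: aLit; pLit]) aLit pLit LitTable (for_cost (Reg rn) n 50)
    (flatten [seq [:: i; T - i] | i <- iota 0 n]) M3.
  apply: emits_for => // [M ag|i M lt_i ag M_i]; first by rewrite /= ag.
  apply: (@emits_weaken [:: aLit; pLit] _ _ _ _ (ecost (Reg ri) + 9 + (ecost (Sub (Reg rT) (Reg ri)) + 9))) => //.
  rewrite -[[:: i; T - i]]/([:: i] ++ [:: T - i]).
  apply: emits_seq => [|M' ag']; apply: emits_emit => //=.
  by rewrite !ag' // M_i ag // M3_T.
apply: runs_seq (lit_em _ st_lit) _ => M4 [ag4 [_ M4_lit]].
have env4 : environment n Cs M4.
  split; rewrite ?ag4 //.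
  - by move=> e lt_e; rewrite M4_lit nth_lit_table.
  - move=> j r lt_j lt_r; rewrite ag4 // ag3 // ag2 // ag1 //.
    by rewrite /M0 /input_memory /= -/Cs nth_flatten_uniform.
have M4_reg a i : a \in [:: aOut; aInc; pInc; pOut] -> M4 a i = 0.
  by rewrite !inE => /or4P[] /eqP->; rewrite ag4 // M3_reg.
have st_inc : stream M4 aInc pInc [::] by split=> [|i]; rewrite M4_reg ?nth_nil.
apply: runs_seq (emits_rows Cs3 Cs_lt env4 st_inc) _ => M5 [ag5 [_ M5_inc]].
have env5 := env_agree ag5 env4 isT.
have st_out : stream M5 aOut pOut [::] by split=> [|i]; rewrite ag5 // M4_reg ?nth_nil.
have em_V : emits [:: aOut; pOut] aOut pOut (Emit aOut pOut (Reg rV)) 50 [:: size ws + N.+2] M5.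
  apply: (@emits_weaken [:: aOut; pOut] _ _ _ _ (ecost (Reg rV) + 9)) => //.
  by apply: emits_emit => //=; rewrite (env_V env5).
apply: runs_seq (em_V _ st_out) _ => M6 [ag6 st6].
have env6 := env_agree ag6 env5 isT.
have em_k : emits [:: aOut; pOut] aOut pOut (Emit aOut pOut (Add (Reg rN) (Const 4))) 50 [:: N + 4] M6.
  apply: (@emits_weaken [:: aOut; pOut] _ _ _ _ (ecost (Add (Reg rN) (Const 4)) + 9)) => //.
  by apply: emits_emit => //=; rewrite (env_N env6).
apply: runs_seq (em_k _ st6) _ => M7 [ag7 st7].
have env7 := env_agree ag7 env6 isT.
have M7_inc i : M7 aInc i = nth 0 (bits (flatten (all_rows N ws))) i by rewrite ag7 // ag6 // M5_inc.
apply: runs_weaken (emits_matrix env7 M7_inc st7) (leqnn _) _ => M8 [_ [_ M8_out]] i _.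
rewrite M8_out /reduction ifN; last by rewrite -lt0n.
by rewrite encode_row_graph.
Qed.

(** * Polynomial bound on the running time *)

Definition poly_bounded (g : cnf3 -> nat) : Prop :=
  exists c d, forall Phi, g Phi <= c * (cnf3_size Phi).+1 ^ d.

Lemma poly_le g h : (forall Phi, g Phi <= h Phi) -> poly_bounded h -> poly_bounded g.
Proof. by move=> le_gh [c [d bound]]; exists c, d => Phi; apply: leq_trans (bound Phi). Qed.

Lemma poly_const k : poly_bounded (fun=> k).
Proof. by exists k, 0 => Phi; rewrite expn0 muln1. Qed.

Lemma poly_size : poly_bounded cnf3_size.
Proof. by exists 1, 1 => Phi; rewrite mul1n expn1. Qed.

Lemma poly_add g h : poly_bounded g -> poly_bounded h -> poly_bounded (fun Phi => g Phi + h Phi).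
Proof.
move=> [c1 [d1 b1]] [c2 [d2 b2]]; exists (c1 + c2), (d1 + d2) => Phi.
have pow_le d d' : (cnf3_size Phi).+1 ^ d <= (cnf3_size Phi).+1 ^ (d + d').
  by rewrite leq_pexp2l // leq_addr.
rewrite mulnDl; apply: leq_add.
  by apply: leq_trans (b1 Phi) _; rewrite leq_mul2l pow_le orbT.
by apply: leq_trans (b2 Phi) _; rewrite addnC leq_mul2l pow_le orbT.
Qed.

Lemma poly_mul g h : poly_bounded g -> poly_bounded h -> poly_bounded (fun Phi => g Phi * h Phi).
Proof.
move=> [c1 [d1 b1]] [c2 [d2 b2]]; exists (c1 * c2), (d1 + d2) => Phi.
by rewrite expnD mulnACA leq_mul.
Qed.

Lemma poly_for_cost e g h : poly_bounded g -> poly_bounded h ->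
  poly_bounded (fun Phi => for_cost e (g Phi) (h Phi)).
Proof.
move=> pg ph; apply: poly_mul.
  by apply: poly_le (poly_add pg (poly_const 1)) => Phi; rewrite addn1.
by do 2 (apply: poly_add; last exact: poly_const).
Qed.

(** Crude, but enough both for the running time and for the linear bound on the number of
    vertices. *)
Lemma code_length_le n : code_length n <= n + 2.
Proof.
rewrite /code_length addn2 !ltnS; case: n => // n.
exact: leq_trans (ltnW (ltn_expl _ _)) (trunc_logP _ _).
Qed.

Lemma poly_total_cost : poly_bounded (fun Phi => (total_cost (nvars Phi) (coded_clauses Phi)).+3).
Proof.
have pn : poly_bounded nvars by apply: poly_le poly_size => Phi; apply: leq_addr.
have pm : poly_bounded (fun Phi => size (coded_clauses Phi)).
  by apply: poly_le poly_size => Phi; rewrite size_map leq_addl.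
have pL : poly_bounded (fun Phi => code_length (nvars Phi)).
  apply: poly_le (poly_add pn (poly_const 2)) => Phi; exact: code_length_le.
have pN : poly_bounded (fun Phi => num_forced (nvars Phi)).
  by apply: poly_le (poly_mul (poly_const 38) pL) => Phi; rewrite /num_forced -muln2; lia.
have p2n : poly_bounded (fun Phi => (nvars Phi).*2).
  by apply: poly_le (poly_add pn pn) => Phi; rewrite addnn.
have pV : poly_bounded (fun Phi => size (vertex_rows (nvars Phi) (coded_clauses Phi)) +
    (num_forced (nvars Phi)).+2).
  have pV' := poly_add p2n (poly_add (poly_mul pm (poly_const 3)) (poly_add pN (poly_const 5))).
  by apply: poly_le pV' => Phi; rewrite size_vertex_rows_list; lia.
have prow : poly_bounded (fun Phi => row_cost (code_length (nvars Phi)) 19).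
  apply: poly_add (poly_const _); apply: poly_mul (poly_const _) _.
  by apply: poly_add (poly_const _) _; apply: poly_for_cost (poly_const _).
have pentry : poly_bounded (fun Phi => entry_cost (nvars Phi)).
  apply: poly_add (poly_const _); apply: poly_add (poly_const _) _.
  by apply: poly_for_cost (poly_const _).
have pstep e g h : poly_bounded g -> poly_bounded h ->
    poly_bounded (fun Phi => for_step_cost e (g Phi) (h Phi)).
  move=> pg ph; apply: poly_add (poly_const _) _; apply: poly_for_cost => //.
  exact: poly_add ph (poly_const _).
have pconst := poly_const.
apply: poly_le (_ : poly_bounded (fun Phi => total_cost (nvars Phi) (coded_clauses Phi) + 3)).
  by move=> Phi; rewrite addn3.
by rewrite /total_cost /rows_cost /matrix_cost;
  repeat first [assumption | apply: pconst | apply: poly_for_cost | apply: pstep | apply: poly_add].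
Qed.

Theorem theorem1 :
  exists f : cnf3 -> ecc_instance,
    [/\ polytime_computable cnf3_size encode_cnf3 encode_ecc f,
        forall Phi : cnf3, satisfiable Phi <-> edge_clique_cover (f Phi),
        exists C : nat, forall Phi : cnf3, 1 < nvars Phi ->
          (f Phi).2 <= C * trunc_log 2 (nvars Phi)
      & exists C : nat, forall Phi : cnf3,
          nverts (f Phi).1 <= C * (nvars Phi + nclauses Phi)].
Proof.
exists reduction; split.
- have [c [d bound]] := poly_total_cost; exists Program, c, d => Phi.
  have [t [M [r le_t out]]] := runs_program Phi.
  by exists t, M; split=> //; apply: leq_trans le_t (bound Phi).
- exact: reduction_correct.
(* Here [k = 38 * (log n + 2) + 4], at most [118 * log n] because [log n] is at least 1. *)
- exists 200 => Phi n_gt1; rewrite /reduction ifN; last by rewrite -lt0n ltnW.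
  have log_gt0 : 0 < trunc_log 2 (nvars Phi) by rewrite trunc_log_gt0.
  by rewrite /= /num_forced /code_length -muln2; lia.
(* There are [2n + 3m + 3] coded vertices and [N + 2] forcing ones, with [N <= 38 * (n + 2)]; the
   constants are absorbed since [n] is positive. *)
- exists 200 => Phi; rewrite /reduction; case: eqVneq => // n_neq0.
  rewrite /= size_vertex_rows_list size_map /num_forced /nclauses.
  by have := code_length_le (nvars Phi); rewrite -!muln2; lia.
Qed.
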